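(* The Weyl group $W_K=\mathfrak{S}_p\times\mathfrak{S}_q$ acts on the orbit space $\mathbb{C}\,\mathfrak{X}/K$ (through the specialization at $\mathbf{q}=1$ of the Hecke algebra action, i.e. by $w\cdot\xi_\tau=\xi_{w\tau}$), and there is an isomorphism of representations of $W_K$ $$\mathbb{C}\,\mathfrak{X}/K\simeq\bigoplus_{(k,s,t)}\mathrm{Ind}_{H_{k,s,t}}^{\mathfrak{S}_p\times\mathfrak{S}_q}\mathbf{1},$$ where the sum runs over all triples $(k,s,t)$ of nonnegative integers with $p\ge k+s$, $q\ge k+t$, $r=k+s+t$, and $\mathbf{1}$ is the trivial representation.
   Context: Let $p,q\ge1$, $n=p+q$, $1\le r\le n-1$; $G=\mathrm{GL}_n$, $K=\mathrm{GL}_p\times\mathrm{GL}_q$ (block diagonal), $B_K=B_p\times B_q$ (upper triangular matrices in each factor), $P\subset G$ the block upper triangular maximal parabolic with diagonal blocks of sizes $r,n-r$, and $\mathfrak{X}=K/B_K\times G/P$ with diagonal $K$-action, over a field of characteristic $\ne 2$. The $K$-orbits on $\mathfrak{X}$ correspond to the $B_K$-orbits on $G/P=\mathrm{Gr}_r$. A partial permutation matrix is a $0/1$ matrix with at most one $1$ in each row and each column. Let $\mathfrak{T}$ be the set of $(p+q)\times r$ matrices $\tau=\binom{\tau_1}{\tau_2}$ of rank $r$ with $\tau_1$ ($p\times r$) and $\tau_2$ ($q\times r$) partial permutation matrices, and $\overline{\mathfrak{T}}=\mathfrak{T}/\mathfrak{S}_r$, where $\mathfrak{S}_r$ permutes columns.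 The map sending $\tau$ to the $B_K$-orbit of the column span $[\tau]$ of $\tau$ is a bijection from $\overline{\mathfrak{T}}$ to the set of $B_K$-orbits on $\mathrm{Gr}_r$, so $\mathbb{C}\,\mathfrak{X}/K$ is the complex vector space with basis $\{\xi_\tau\}_{\tau\in\overline{\mathfrak{T}}}$ indexed by $K$-orbits. $W_K=\mathfrak{S}_p\times\mathfrak{S}_q$ acts on $\overline{\mathfrak{T}}$ by left multiplication by permutation matrices (permuting the first $p$ rows and the last $q$ rows). For $(k,s,t)$ as in the claim put $s'=p-k-s$, $t'=q-k-t$, and $$H_{k,s,t}=\{(a_1,a_2,a_3;\,a_1,b_2,b_3)\in(\mathfrak{S}_k\times\mathfrak{S}_s\times\mathfrak{S}_{s'})\times(\mathfrak{S}_k\times\mathfrak{S}_t\times\mathfrak{S}_{t'})\}\subset\mathfrak{S}_p\times\mathfrak{S}_q,$$ so $H_{k,s,t}\cong\Delta\mathfrak{S}_k\times\mathfrak{S}_s\times\mathfrak{S}_{s'}\times\mathfrak{S}_t\times\mathfrak{S}_{t'}$, where $\Delta\mathfrak{S}_k\subset\mathfrak{S}_k\times\mathfrak{S}_k$ is the diagonal subgroup. *)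

(* Defs.v *)
From HB Require Import structures.
From mathcomp Require Import all_boot all_order all_algebra all_fingroup.
From mathcomp Require Import boolp classical_sets reals.
From mathcomp Require Import complex monalg.

Set Implicit Arguments.
Unset Strict Implicit.
Unset Printing Implicit Defensive.

Import Order.TTheory GRing.Theory.

Local Open Scope ring_scope.

Section Representations.
Variables (C : fieldType) (gT : finGroupType).
Implicit Type G : {group gT}.

(* A linear representation of G, the values outside G being irrelevant (as in   *)
(* mxrepresentation.v).                                                       *)
Definition is_rep G (V : lmodType C) (rho : gT -> V -> V) : Prop :=
  [/\ forall g, linear (rho g),
      forall v, rho 1%g v = v
    & {in G &, forall g h, forall v, rho (g * h)%g v = rho g (rho h v)}].

Record representation G := Representation {
  rep_space : lmodType C;
  rep_act : gT -> rep_space -> rep_space;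
  rep_actP : is_rep G rep_act
}.

Definition rep_iso G (V W : lmodType C)
    (rho : gT -> V -> V) (sigma : gT -> W -> W) : Prop :=
  exists f : V -> W,
    [/\ linear f, bijective f
      & {in G, forall g, forall v, f (rho g v) = sigma g (f v)}].

Lemma trivial_repP G : is_rep G (fun (_ : gT) (v : C^o) => v).
Proof. by split. Qed.

Definition trivial_rep G : representation G := Representation (trivial_repP G).

(* The neutral element of the direct sum: the zero-dimensional space. *)
Lemma zero_repP G : is_rep G (fun (_ : gT) (v : 'rV[C]_0) => v).
Proof. by split. Qed.

Definition zero_rep G : representation G := Representation (zero_repP G).

Lemma sum_repP G (V W : representation G) :
  is_rep G (fun g (x : (rep_space V * rep_space W)%type) =>
              (rep_act g x.1, rep_act g x.2)).
Proof.
have [linV V1 VM] := rep_actP V; have [linW W1 WM] := rep_actP W.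
split=> [g a [x1 x2] [y1 y2] | [x1 x2] | g h Gg Gh [x1 x2]] /=.
- by rewrite linV linW.
- by rewrite V1 W1.
- by rewrite VM ?WM.
Qed.

Definition sum_rep G (V W : representation G) : representation G :=
  Representation (sum_repP V W).

Section Induction.
Variables (H : {group gT}) (V : representation H).

Definition ind_pred : {pred {ffun gT -> rep_space V}} :=
  [pred f : {ffun gT -> rep_space V} |
     [forall h in H, forall x, f (h * x)%g == rep_act h (f x)]].

Lemma ind_predP (f : {ffun gT -> rep_space V}) :
  reflect (forall h x, h \in H -> f (h * x)%g = rep_act h (f x))
          (f \in ind_pred).
Proof.
apply: (iffP forall_inP) => [fH h x Hh | fH h Hh].
  by apply/eqP/(forallP (fH h Hh)).
by apply/forallP=> x; rewrite fH.
Qed.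

Lemma ind_submod_closed : submod_closed ind_pred.
Proof.
have [linV _ _] := rep_actP V.
split=> [|a f g /ind_predP fH /ind_predP gH]; apply/ind_predP=> h x Hh.
  by have := linV h (-1) 0 0; rewrite scaler0 addr0 scaleN1r addNr !ffunE.
by rewrite !ffunE fH // gH // linV.
Qed.

HB.instance Definition _ := GRing.isSubmodClosed.Build C
  {ffun gT -> rep_space V} ind_pred ind_submod_closed.

Record ind_space := IndSpace {
  ind_val : {ffun gT -> rep_space V};
  ind_valP : ind_val \in ind_pred
}.

HB.instance Definition _ := [isSub for ind_val].
HB.instance Definition _ := [Choice of ind_space by <:].
HB.instance Definition _ := [SubChoice_isSubLmodule of ind_space by <:].

Lemma ind_act_subproof (g : gT) (f : ind_space) :
  [ffun x => ind_val f (x * g)%g] \in ind_pred.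
Proof.
apply/ind_predP=> h x Hh; rewrite !ffunE -mulgA.
exact: (ind_predP _ (ind_valP f)).
Qed.

Definition ind_act (g : gT) (f : ind_space) : ind_space :=
  IndSpace (ind_act_subproof g f).

Lemma ind_repP : is_rep [set: gT]%G ind_act.
Proof.
split=> [g a f1 f2 | f | g h _ _ f]; apply/val_inj/ffunP=> x.
- by rewrite !ffunE.
- by rewrite !ffunE mulg1.
- by rewrite !ffunE mulgA.
Qed.

(* Ind_H V = {f : gT -> V | f (h x) = h (f x) for h in H}, with gT acting by  *)
(* right translation.                                                         *)
Definition ind_rep : representation [set: gT]%G := Representation ind_repP.

End Induction.
End Representations.

Section YoungSubgroup.
Variables p q k s t : nat.

(* u restricts to the permutation a on the block {d, ..., d + m - 1}. *)
Definition acts_on_block (n m d : nat) (u : 'S_n) (a : 'S_m) : bool :=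
  [forall i : 'I_n, forall j : 'I_m,
     ((i : nat) == d + j)%N ==> ((u i : nat) == d + a j)%N].

Lemma acts_on_blockP n m d (u : 'S_n) (a : 'S_m) :
  reflect (forall (i : 'I_n) (j : 'I_m),
             i = (d + j)%N :> nat -> u i = (d + a j)%N :> nat)
          (acts_on_block d u a).
Proof.
apply: (iffP forallP) => [ua i j ij | ua i].
  by apply/eqP/(implyP (forallP (ua i) j))/eqP.
by apply/forallP=> j; apply/implyP=> /eqP/ua->.
Qed.

Lemma acts_on_block1 n m d : acts_on_block d (1 : 'S_n)%g (1 : 'S_m)%g.
Proof. by apply/acts_on_blockP=> i j; rewrite !perm1. Qed.

Lemma acts_on_blockM n m d (u v : 'S_n) (a b : 'S_m) :
  acts_on_block d u a -> acts_on_block d v b ->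
  acts_on_block d (u * v)%g (a * b)%g.
Proof.
move=> /acts_on_blockP ua /acts_on_blockP vb; apply/acts_on_blockP=> i j ij.
by rewrite !permM; apply: vb; apply: ua.
Qed.

Definition H_set : {set 'S_p * 'S_q} :=
  [set w |
    [exists a1 : 'S_k,
     exists a2 : 'S_s, exists a3 : 'S_(p - k - s),
     exists b2 : 'S_t, exists b3 : 'S_(q - k - t),
     [&& acts_on_block 0 w.1 a1, acts_on_block k w.1 a2,
         acts_on_block (k + s) w.1 a3,
         acts_on_block 0 w.2 a1, acts_on_block k w.2 b2
       & acts_on_block (k + t) w.2 b3]]].

Lemma H_group_set : group_set H_set.
Proof.
apply/group_setP; split=> [|x y].
  rewrite inE; do 5!(apply/existsP; exists 1%g).
  by rewrite !acts_on_block1.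
rewrite !inE.
move=> /existsP[a1 /existsP[a2 /existsP[a3 /existsP[b2 /existsP[b3]]]]].
move=> /and5P[x1 x2 x3 x4 /andP[x5 x6]].
move=> /existsP[c1 /existsP[c2 /existsP[c3 /existsP[d2 /existsP[d3]]]]].
move=> /and5P[y1 y2 y3 y4 /andP[y5 y6]].
apply/existsP; exists (a1 * c1)%g; apply/existsP; exists (a2 * c2)%g.
apply/existsP; exists (a3 * c3)%g; apply/existsP; exists (b2 * d2)%g.
by apply/existsP; exists (b3 * d3)%g; rewrite !acts_on_blockM.
Qed.

Canonical H_group : {group 'S_p * 'S_q} := Group H_group_set.

End YoungSubgroup.

Section OrbitSpace.
Variables (F : fieldType) (p q r : nat).
Local Open Scope classical_set_scope.

Definition GL_pq : set 'M[F]_(p + q) := [set g | g \in unitmx].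

Definition K_pq : set 'M[F]_(p + q) :=
  [set g | exists (k1 : 'M[F]_p) (k2 : 'M[F]_q),
     [/\ k1 \in unitmx, k2 \in unitmx & g = block_mx k1 0 0 k2]].

(* is_trig_mx means lower triangular, hence the transposes. *)
Definition BK_pq : set 'M[F]_(p + q) :=
  [set g | exists (b1 : 'M[F]_p) (b2 : 'M[F]_q),
     [/\ b1 \in unitmx, b2 \in unitmx, is_trig_mx b1^T, is_trig_mx b2^T
       & g = block_mx b1 0 0 b2]].

Definition P_r : set 'M[F]_(p + q) :=
  [set g | g \in unitmx /\
     forall i j : 'I_(p + q), (j < r)%N -> (r <= i)%N -> g i j = 0].

Definition lmulset (g : 'M[F]_(p + q)) (A : set 'M[F]_(p + q)) :
  set 'M[F]_(p + q) := [set g *m a | a in A].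

Definition coset_space (L Q : set 'M[F]_(p + q)) :
  set (set 'M[F]_(p + q)) := [set lmulset g Q | g in L].

Definition X_pq : set (set 'M[F]_(p + q) * set 'M[F]_(p + q)) :=
  coset_space K_pq BK_pq `*` coset_space GL_pq P_r.

Definition K_orbit (x : set 'M[F]_(p + q) * set 'M[F]_(p + q)) :
  set (set 'M[F]_(p + q) * set 'M[F]_(p + q)) :=
  [set (lmulset h x.1, lmulset h x.2) | h in K_pq].

Definition K_orbits : set (set (set 'M[F]_(p + q) * set 'M[F]_(p + q))) :=
  [set K_orbit x | x in X_pq].

(* The space of finitely supported functions on the set of K-orbits; the      *)
(* basis vector attached to an orbit o is << o >>.                            *)
Definition orbit_space (C : fieldType) : lmodType C := {malg C[K_orbits]}.

Definition is_partial_perm m n (A : 'M[F]_(m, n)) : bool :=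
  [&& [forall i, forall j, (A i j == 0) || (A i j == 1)],
      [forall i, (#|[pred j | A i j == 1%R]| <= 1)%N]
    & [forall j, (#|[pred i | A i j == 1%R]| <= 1)%N]].

Record tau_mx := TauMx {
  tau_val :> 'M[F]_(p + q, r);
  tau_valP : [&& \rank tau_val == r, is_partial_perm (usubmx tau_val)
               & is_partial_perm (dsubmx tau_val)]
}.

(* The point of G/P corresponding to the column span of M under               *)
(* G/P = Gr_r, g P |-> g <e_1, ..., e_r>.                                     *)
Definition span_coset (M : 'M[F]_(p + q, r)) : set 'M[F]_(p + q) :=
  [set g | g \in unitmx /\
     ((g *m (pid_mx r : 'M[F]_(p + q, r)))^T :=: M^T)%MS].

Lemma span_cosetP (M : 'M[F]_(p + q, r)) :
  \rank M = r -> coset_space GL_pq P_r (span_coset M).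
Proof.
move=> rM; have le_rn : (r <= p + q)%N by rewrite -{1}rM rank_leq_row.
set E : 'M[F]_(p + q, r) := pid_mx r.
have EE (x : 'M[F]_(p + q)) :
    (forall i j : 'I_(p + q), (j < r)%N -> (r <= i)%N -> x i j = 0) <->
    ((x *m E)^T <= E^T)%MS.
  have xE i (j : 'I_r) : (x *m E) i j = x i (widen_ord le_rn j).
    rewrite mxE (bigD1 (widen_ord le_rn j)) //= big1 ?addr0 => [|l ne_lj].
      by rewrite !mxE /= eqxx ltn_ord mulr1.
    by rewrite !mxE (_ : (l == j :> nat) = false) ?mulr0 //; exact/negbTE.
  split=> [x0|/submxP[D defD] i j lt_jr le_ri].
    apply/submxP.
    exists (\matrix_(j, l) x (widen_ord le_rn l) (widen_ord le_rn j)).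
    apply: trmx_inj; rewrite trmxK trmx_mul trmxK; apply/matrixP=> i j.
    rewrite xE mxE; have [lt_ir|le_ri] := ltnP i r.
      rewrite (bigD1 (Ordinal lt_ir)) //= big1 ?addr0 => [|l ne_li].
        rewrite !mxE /= eqxx lt_ir mul1r; congr (x _ _); exact/val_inj.
      rewrite !mxE (_ : (i == l :> nat) = false) ?mul0r //.
      by rewrite eq_sym; apply/negbTE.
    have -> : x i (widen_ord le_rn j) = 0.
      by apply: x0 => //=; apply: ltn_ord.
    rewrite big1 // => l _.
    by rewrite !mxE ltnNge le_ri andbF mul0r.
  rewrite (_ : j = widen_ord le_rn (Ordinal lt_jr)); last exact/val_inj.
  have := congr1 (fun A : 'M[F]_(r, p + q) => A (Ordinal lt_jr) i) defD.
  rewrite mxE xE => ->; rewrite mxE big1 // => l _.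
  by rewrite !mxE ltnNge le_ri andbF mulr0.
have rE : \rank E = r by rewrite rank_pid_mx.
pose g0 := (row_ebase M^T)^T.
have g0U : g0 \in unitmx by rewrite unitmx_tr row_ebase_unit.
have g0M : ((g0 *m E)^T :=: M^T)%MS.
  rewrite trmx_mul trmxK tr_pid_mx -[X in (_ :=: X)%MS]mulmx_ebase mxrank_tr rM.
  rewrite -mulmxA; apply/eqmx_sym/eqmxMfull.
  by rewrite row_full_unit col_ebase_unit.
exists g0 => //; apply/seteqP; split=> [_ [x [xU /EE xE] <-] | g [gU gM]].
  split; first by rewrite unitmx_mul g0U.
  have xE' : ((x *m E)^T :=: E^T)%MS.
    apply/eqmxP; rewrite -(mxrank_leqif_eq xE).2 !mxrank_tr.
    by rewrite eqmxMfull // row_full_unit.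
  apply: eqmx_trans g0M; rewrite -mulmxA !(trmx_mul g0).
  exact: eqmxMr.
exists (invmx g0 *m g); last by rewrite mulKVmx.
split; first by rewrite unitmx_mul unitmx_inv g0U.
apply/EE; rewrite -mulmxA trmx_mul.
have /eqmxP/andP[+ _] := eqmx_trans gM (eqmx_sym g0M).
move=> /(submxMr (invmx g0)^T); rewrite -[X in (_ <= X)%MS]trmx_mul.
by rewrite mulKmx.
Qed.

Lemma tau_orbitP (tau : tau_mx) : K_orbit (BK_pq, span_coset tau) \in K_orbits.
Proof.
rewrite inE; exists (BK_pq, span_coset tau) => //; split=> /=.
  exists 1%:M; last first.
    by rewrite /lmulset; under eq_imagel do rewrite mul1mx; exact: image_id.
  by exists 1%:M, 1%:M; rewrite !unitmx1 -scalar_mx_block.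
by apply: span_cosetP; case/and3P: (tau_valP tau) => /eqP.
Qed.

Definition tau_orbit (tau : tau_mx) : K_orbits := SigSub (tau_orbitP tau).

Definition xi (C : fieldType) (tau : tau_mx) : orbit_space C :=
  << tau_orbit tau >>.

Definition W_mx (w : 'S_p * 'S_q) : 'M[F]_(p + q) :=
  block_mx (perm_mx w.1) 0 0 (perm_mx w.2).

Lemma is_partial_perm_row m n (u : 'S_m) (A : 'M[F]_(m, n)) :
  is_partial_perm A -> is_partial_perm (perm_mx u *m A).
Proof.
move=> /and3P[/forallP A01 /forallP Ar /forallP Ac]; rewrite -row_permE.
apply/and3P; split; apply/forallP=> i.
- by apply/forallP=> j; rewrite mxE; apply: (forallP (A01 (u i))).
- rewrite (eq_card (B := [pred j | A (u i) j == 1])); first exact: Ar.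
  by move=> j; rewrite !inE mxE.
- rewrite -(card_imset _ (@perm_inj _ u)); apply: leq_trans (Ac i).
  apply/subset_leq_card/fintype.subsetP=> _ /imsetP[j + ->].
  by rewrite !inE mxE.
Qed.

Lemma W_tauP (w : 'S_p * 'S_q) (tau : tau_mx) :
  [&& \rank (W_mx w *m tau) == r, is_partial_perm (usubmx (W_mx w *m tau))
    & is_partial_perm (dsubmx (W_mx w *m tau))].
Proof.
have /and3P[rt t1 t2] := tau_valP tau; apply/and3P; split.
- rewrite eqmxMfull // row_full_unit unitmxE det_ublock unitrM.
  by rewrite -!unitmxE !unitmx_perm.
- rewrite -[X in _ *m X]vsubmxK mul_block_col col_mxKu mul0mx addr0.
  exact: is_partial_perm_row.
- rewrite -[X in _ *m X]vsubmxK mul_block_col col_mxKd mul0mx add0r.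
  exact: is_partial_perm_row.
Qed.

(* The library product of permutations is (u * v) i = v (u i), for which      *)
(* w |-> W_mx w is multiplicative: this is a left action of 'S_p * 'S_q.      *)
Definition W_tau (w : 'S_p * 'S_q) (tau : tau_mx) : tau_mx :=
  TauMx (W_tauP w tau).

End OrbitSpace.

(* Main.v *)
Require Import Defs.
From mathcomp Require Import all_boot all_order all_algebra all_fingroup.
From mathcomp Require Import boolp classical_sets reals.
From mathcomp Require Import complex monalg zify.

(** Everything rests on a permutation representation being the direct sum,
    over the orbits of the group, of the representations induced from the
    trivial representations of the stabilizers ([perm_rep_iso]).  It remains
    to know the set of K-orbits on X as a set with an action of S_p x S_q,
    which splits into a geometric and a combinatorial question.

    Geometry: K-orbits on X are classified by the matrices tau up to
    permutation of their columns.
    - Every orbit contains some tau ([tau_orbit_surj]): by [normalizable_all]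
      two matrices with the same number of columns can be brought to partial
      permutation matrices by upper triangular row operations on each of them
      and common column operations.  This is an instance of the representation
      theory of quivers of type A, done here by an induction which splits off
      one row of one of the two matrices at a time.
    - The orbit of tau determines tau up to permutation of the columns, and
      conversely ([tau_orbitE]).  Here tau is encoded, up to column
      permutations, by its pattern: the occupied rows of the two blocks, and
      the pairs consisting of a row of the top block and a row of the bottom
      block whose 1's are in the same column.  The subspaces of F^p + F^q
      spanned by initial segments of the two bases are stable under B_K, so
      the dimensions of their intersections with the span of tau are
      invariants of the orbit; they count columns of tau ([rank_tail_proj]),
      and the pattern is recovered from these counts by taking differences
      ([tail_cols_sum], [tail_cols_inj]).

    Combinatorics: a pattern is a partial matching between {1..p} and {1..q}
    together with some unmatched occupied points on either side.  Under
    S_p x S_q it is equivalent to the standard one having k matched pairs i-i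
    with i < k, then s and t unmatched points ([to_std]); k, s and t are
    determined by the pattern ([is_std_inj]), and the stabilizer of the
    standard pattern is H_{k,s,t} ([stab_std]). *)

Set Implicit Arguments.
Unset Strict Implicit.
Unset Printing Implicit Defensive.

Import Order.TTheory GRing.Theory.

Local Open Scope ring_scope.

(** * Upper triangular matrices *)

Section Borel.
Variable F : fieldType.

Definition borel n (b : 'M[F]_n) : bool := (b \in unitmx) && is_trig_mx b^T.

Lemma borelP n (b : 'M[F]_n) :
  reflect (b \in unitmx /\ forall i j : 'I_n, (j < i)%N -> b i j = 0) (borel b).
Proof.
apply: (iffP andP) => -[bU bT]; split=> //.
  by move=> i j lt_ji; have /is_trig_mxP/(_ j i lt_ji) := bT; rewrite mxE.
by apply/is_trig_mxP=> i j lt_ij; rewrite mxE bT.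
Qed.

Lemma borel1 n : borel (1%:M : 'M[F]_n).
Proof. by rewrite /borel unitmx1 trmx1 scalar_mx_is_trig. Qed.

Lemma borel_ublock n (b : 'M[F]_n) (z : 'cV_n) :
  borel b -> borel (block_mx b z 0 1%:M : 'M[F]_(n + 1)).
Proof.
case/borelP=> bU bT; apply/borelP; split=> [|i j].
  by rewrite unitmxE det_ublock det1 mulr1 -unitmxE.
case: (split_ordP i) => {}i ->; case: (split_ordP j) => {}j -> /=.
- by rewrite block_mxEul; apply: bT.
- by rewrite ltnNge (leq_trans (ltnW (ltn_ord i))) ?leq_addr.
- by rewrite block_mxEdl mxE.
- by rewrite !ord1 ltnn.
Qed.

Lemma borelM n (b c : 'M[F]_n) : borel b -> borel c -> borel (b *m c).
Proof.
move=> /borelP[bU bT] /borelP[cU cT]; apply/borelP; split=> [|i j lt_ji].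
  by rewrite unitmx_mul bU.
rewrite mxE big1 // => l _; have [lt_li|le_il] := ltnP l i.
  by rewrite bT ?mul0r.
by rewrite cT ?mulr0 // (leq_trans lt_ji).
Qed.

Lemma borel_diag_neq0 n (b : 'M[F]_n) i : borel b -> b i i != 0.
Proof.
case/andP; rewrite unitmxE unitfE -det_tr => + bT.
by rewrite det_trig // => /prodf_neq0/(_ i isT); rewrite mxE.
Qed.

Lemma borelV n (b : 'M[F]_n) : borel b -> borel (invmx b).
Proof.
move=> bB; have /borelP[bU bT] := bB; apply/borelP.
split=> [|i j]; first by rewrite unitmx_inv.
have [k] := ubnP (j : nat); elim: k j => // k IHk j le_jk lt_ji.
have := congr1 (fun A : 'M_n => A i j) (mulVmx bU).
rewrite !mxE (_ : (i == j) = false); last first.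
  by apply/negbTE; rewrite -val_eqE /= neq_ltn lt_ji orbT.
rewrite (bigD1 j) //= big1 ?addr0 => [/eqP|l ne_lj].
  by rewrite mulf_eq0 (negPf (borel_diag_neq0 j bB)) orbF => /eqP.
have [lt_lj|lt_jl|eq_lj] := ltngtP l j.
- have lt_lk : (l < k)%N by exact: leq_trans lt_lj _.
  by rewrite IHk ?mul0r // (ltn_trans lt_lj).
- by rewrite bT ?mulr0.
- by rewrite (val_inj eq_lj) eqxx in ne_lj.
Qed.

(** The rows below the lowest nonzero entry of w are kept, that entry is scaled
    to 1 and used to clear the entries above it.  Such an operation only adds
    multiples of the pivot row, or rescales it, hence is invisible to a matrix
    T whose pivot row vanishes. *)
Lemma borel_pivot q (w : 'cV[F]_q) :
  exists2 b : 'M[F]_q, borel b &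
    (forall m (T : 'M[F]_(q, m)),
          (forall i c, w i 0 != 0 -> T i c = 0) -> b *m T = T) /\
    (b *m w = 0 \/ exists2 j, w j 0 != 0 & b *m w = delta_mx j 0).
Proof.
case: (pickP (fun j => w j 0 != 0)) => [j0 wj0|w0]; last first.
  exists 1%:M; first exact: borel1.
  split=> [m T _|]; first by rewrite mul1mx.
  by left; rewrite mul1mx; apply/colP=> i; rewrite mxE; apply/eqP/negbFE/w0.
case: (@arg_maxnP 'I_q j0 (fun j => w j 0 != 0) (@nat_of_ord q) wj0) => j wj jmax.
(* 1 + z e_j^T fixes e_i for i <> j, and sends w to e_j. *)
pose z : 'cV[F]_q := (w j 0)^-1 *: (delta_mx j 0 - w).
have jE m (T : 'M[F]_(q, m)) : delta_mx 0 j *m T = row j T by rewrite -rowE.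
have bE m (T : 'M[F]_(q, m)) :
  (1%:M + z *m delta_mx 0 j) *m T = T + z *m row j T.
  by rewrite mulmxDl mul1mx -mulmxA jE.
have bw : (1%:M + z *m delta_mx 0 j) *m w = delta_mx j 0.
  rewrite bE (_ : row j w = (w j 0)%:M); last first.
    by apply/matrixP=> a b; rewrite !ord1 !mxE eqxx mulr1n.
  by rewrite mul_mx_scalar scalerA divff // scale1r addrC subrK.
exists (1%:M + z *m delta_mx 0 j); last first.
  split=> [m T T0|]; last by right; exists j.
  rewrite bE (_ : row j T = 0) ?mulmx0 ?addr0 //.
  by apply/rowP=> c; rewrite !mxE T0.
have bT : is_trig_mx (1%:M + z *m delta_mx 0 j)^T.
  apply/is_trig_mxP=> i l lt_il.
  rewrite !mxE big_ord1 !mxE eqxx /= (_ : (l == i) = false); last first.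
    by apply/negbTE; rewrite -val_eqE /= neq_ltn lt_il orbT.
  have [eq_ij|_] := eqVneq i j; rewrite ?mulr0 ?addr0 //.
  rewrite -eq_ij (_ : (l == i) = false) ?andFb; last first.
    by apply/negbTE; rewrite -val_eqE /= neq_ltn lt_il orbT.
  rewrite [w l 0](_ : _ = 0) ?subr0 ?mulr0 ?mul0r ?addr0 //.
  apply/eqP/negPn/negP=> /jmax /=; apply/negP.
  by rewrite -ltnNge -eq_ij.
apply/andP; split=> //; rewrite unitmxE unitfE -det_tr det_trig //.
apply/prodf_neq0=> i _; rewrite !mxE big_ord1 !mxE !eqxx /=.
have [->|_] := eqVneq i j; last by rewrite mulr0 addr0 oner_neq0.
rewrite mulr1 mulrBr mulr1 mulVf // addrC subrK invr_neq0 //.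
Qed.

End Borel.

(** * Normal forms of pairs of matrices *)

Section PartialPermutations.
Variable F : fieldType.

(** Entries are tested against 0 instead of 1, so that membership in the support
    is the only boolean to be reasoned about. *)
Lemma partial_permP m n (A : 'M[F]_(m, n)) :
  reflect [/\ forall i j, A i j = (A i j != 0)%:R,
              forall i j j', A i j != 0 -> A i j' != 0 -> j = j'
            & forall i i' j, A i j != 0 -> A i' j != 0 -> i = i']
          (is_partial_perm A).
Proof.
have le1P (T : finType) (P : pred T) :
    reflect (forall x y, P x -> P y -> x = y) (#|P| <= 1)%N.
  apply: (iffP card_le1_eqP) => PP x y Px Py; first exact: PP.
  by apply: PP.
apply: (iffP and3P) => [[/forallP A01 /forallP Ar /forallP Ac]|[A01 Ar Ac]].
  have E i j : (A i j != 0) = (A i j == 1).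
    case/orP: (forallP (A01 i) j) => /eqP->; rewrite ?eqxx ?oner_eq0 //.
    by rewrite eq_sym oner_eq0.
  split=> [i j|i j j'|i i' j]; rewrite ?E.
  - case/orP: (forallP (A01 i) j) => /eqP->; rewrite ?eqxx //.
    by rewrite eq_sym oner_eq0.
  - by have /le1P := Ar i; apply.
  - by have /le1P := Ac j; apply.
have E i j : (A i j == 1) = (A i j != 0).
  by rewrite A01; case: (A i j != 0); rewrite ?eqxx ?oner_eq0 // eq_sym oner_eq0.
split; apply/forallP=> i.
- by apply/forallP=> j; rewrite E orbN.
- by apply/le1P=> j j'; rewrite /= !E; apply: Ar.
- by apply/le1P=> j j'; rewrite /= !E; apply: Ac.
Qed.

Lemma partial_perm_col0 n m k (T : 'M[F]_(n, m)) :
  is_partial_perm T -> is_partial_perm (col_mx T (0 : 'M_(k, m))).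
Proof.
move=> /partial_permP[T01 Tr Tc]; apply/partial_permP; split=> [i j|i j j'|i i' j].
- by case: (split_ordP i) => {}i ->; rewrite ?col_mxEu ?col_mxEd ?mxE ?eqxx.
- case: (split_ordP i) => {}i ->; rewrite ?col_mxEu ?col_mxEd; first exact: Tr.
  by rewrite mxE eqxx.
- case: (split_ordP i) => {}i ->; case: (split_ordP i') => {}i' ->;
    rewrite ?col_mxEu ?col_mxEd ?[const_mx _ _ _]mxE ?eqxx //.
  by move=> Ti /(Tc _ _ _ Ti)->.
Qed.

Lemma partial_perm_antiblock n m (T : 'M[F]_(n, m)) :
  is_partial_perm T ->
  is_partial_perm (block_mx (0 : 'cV_n) T 1%:M 0 : 'M_(n + 1, 1 + m)).
Proof.
move=> /partial_permP[T01 Tr Tc]; apply/partial_permP; split=> [i j|i j j'|i i' j].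
- case: (split_ordP i) => {}i ->; case: (split_ordP j) => {}j ->;
    rewrite ?block_mxEul ?block_mxEur ?block_mxEdl ?block_mxEdr ?mxE ?eqxx //.
  by rewrite !ord1 eqxx oner_eq0.
- case: (split_ordP i) => {}i ->; case: (split_ordP j) => {}j ->;
  case: (split_ordP j') => {}j' ->;
    rewrite ?block_mxEul ?block_mxEur ?block_mxEdl ?block_mxEdr;
    rewrite ?[const_mx _ _ _]mxE ?eqxx //; first by move=> Tj /(Tr _ _ _ Tj)->.
  by rewrite !ord1.
- case: (split_ordP i) => {}i ->; case: (split_ordP j) => {}j ->;
  case: (split_ordP i') => {}i' ->;
    rewrite ?block_mxEul ?block_mxEur ?block_mxEdl ?block_mxEdr;
    rewrite ?[const_mx _ _ _]mxE ?eqxx //; first by move=> Tj /(Tc _ _ _ Tj)->.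
  by rewrite !ord1.
Qed.

Lemma partial_perm_row0 n m (T : 'M[F]_(n, m)) :
  is_partial_perm T -> is_partial_perm (row_mx (0 : 'cV_n) T).
Proof.
move=> /partial_permP[T01 Tr Tc]; apply/partial_permP; split=> [i j|i j j'|i i' j].
- by case: (split_ordP j) => {}j ->; rewrite ?row_mxEl ?row_mxEr ?mxE ?eqxx.
- case: (split_ordP j) => {}j ->; case: (split_ordP j') => {}j' ->;
    rewrite ?row_mxEl ?row_mxEr ?[const_mx _ _ _]mxE ?eqxx //.
  by move=> Ti /(Tr _ _ _ Ti)->.
- case: (split_ordP j) => {}j ->; rewrite ?row_mxEl ?row_mxEr; last exact: Tc.
  by rewrite mxE eqxx.
Qed.

Lemma partial_perm_row_delta n m (T : 'M[F]_(n, m)) (l : 'I_n) :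
  (forall c, T l c = 0) ->
  is_partial_perm T -> is_partial_perm (row_mx (delta_mx l 0 : 'cV_n) T).
Proof.
move=> T0 /partial_permP[T01 Tr Tc]; apply/partial_permP.
have dE i (j : 'I_1) : (delta_mx l 0 : 'cV[F]_n) i j = (i == l)%:R.
  by rewrite mxE ord1 andbT.
have bE (b : bool) : (b%:R != 0 :> F) = b.
  by case: b; rewrite ?oner_eq0 ?eqxx.
split=> [i j|i j j'|i i' j].
- by case: (split_ordP j) => {}j ->; rewrite ?row_mxEl ?row_mxEr ?dE ?bE.
- case: (split_ordP j) => {}j ->; case: (split_ordP j') => {}j' ->;
    rewrite ?row_mxEl ?row_mxEr ?dE ?bE.
  + by rewrite !ord1.
  + by move/eqP->; rewrite T0 eqxx.
  + by move=> + /eqP il; rewrite il T0 eqxx.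
  + by move=> Ti /(Tr _ _ _ Ti)->.
- case: (split_ordP j) => {}j ->; rewrite ?row_mxEl ?row_mxEr; last exact: Tc.
  by rewrite !dE !bE => /eqP-> /eqP->.
Qed.

(** The rows where T is nonzero are distinct standard basis vectors, so column
    operations with the columns of T kill the entries of w on these rows; the
    multipliers are the entries of - T^T w, as T T^T is the projection on the
    rows occupied by T. *)
Lemma partial_perm_clear n m (T : 'M[F]_(n, m)) (w : 'cV[F]_n) :
  is_partial_perm T ->
  exists y : 'cV_m, forall i c, (w + T *m y) i 0 != 0 -> T i c = 0.
Proof.
move=> /partial_permP[T01 Tr Tc]; exists (- (T^T *m w)) => i c.
apply: contraNeq => Tic; apply/eqP; rewrite mulmxN [LHS]mxE [X in _ + X]mxE.
rewrite (_ : (T *m (T^T *m w)) i 0 = w i 0) ?subrr // mxE (bigD1 c) //=.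
rewrite [X in _ + X]big1 => [|c' ne_c].
  rewrite addr0 mxE (bigD1 i) //= big1 => [|i' ne_i].
    by rewrite mxE T01 Tic !mul1r addr0.
  rewrite mxE; case: (eqVneq (T i' c) 0) => [->|Ti']; first by rewrite mul0r.
  by rewrite (Tc _ _ _ Ti' Tic) eqxx in ne_i.
case: (eqVneq (T i c') 0) => [->|Tic']; first by rewrite mul0r.
by rewrite (Tr _ _ _ Tic' Tic) eqxx in ne_c.
Qed.

(** Splitting off the kernel of a nonzero linear form. *)
Lemma row_to_e1 m (l : 'rV[F]_(1 + m)) :
  l != 0 -> exists2 A : 'M[F]_(1 + m), A \in unitmx & l *m A = row_mx 1%:M 0.
Proof.
move=> l0; have rl : \rank l = 1%N by rewrite rank_rV l0.
set c := col_ebase l; have cU : c \in unitmx by exact: col_ebase_unit.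
have c0 : c 0 0 != 0.
  by move: cU; rewrite unitmxE unitfE [c]mx11_scalar det_scalar1 mxE eqxx mulr1n.
exists ((c 0 0)^-1 *: invmx (row_ebase l)).
  by rewrite unitmxZ ?unitfE ?invr_neq0 // unitmx_inv row_ebase_unit.
rewrite -[X in X *m _]mulmx_ebase rl -scalemxAr mulmxK ?row_ebase_unit //.
rewrite pid_mx_row -/c [c]mx11_scalar mul_scalar_mx scalerA.
by rewrite [_%:M 0 0]mxE eqxx mulr1n mulVf // scale1r.
Qed.

(** Normal forms for a pair of flags and a pair of linear maps F^m -> F^p,
    F^m -> F^q.  The rank of the pair is arbitrary, since an induction passes
    through pairs which are not injective. *)
Definition normalizable p q := forall m (M1 : 'M[F]_(p, m)) (M2 : 'M[F]_(q, m)),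
  exists b1 b2 A, [/\ borel b1, borel b2, A \in unitmx,
    is_partial_perm (b1 *m M1 *m A) & is_partial_perm (b2 *m M2 *m A)].

Lemma normalizable_sym p q : normalizable p q -> normalizable q p.
Proof.
move=> Q m M1 M2; have [b1 [b2 [A [? ? ? ? ?]]]] := Q m M2 M1.
by exists b2, b1, A.
Qed.

Lemma normalizable0 : normalizable 0 0.
Proof.
move=> m M1 M2; exists 1%:M, 1%:M, 1%:M; rewrite !borel1 unitmx1.
by split=> //; apply/partial_permP; split=> -[].
Qed.

(** Let l be the last row of M1, which upper triangular row operations can only
    rescale.  If l = 0 it can be removed.  Otherwise choose coordinates such that
    l is the first coordinate: the other columns span ker l and are normalized
    by induction, to T1 and T2.  The first column can be modified by any vector
    of ker l at no cost on the M1 side, because there l clears all the entries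
    above it; on the M2 side this makes the first column vanish on the rows
    occupied by T2, after which [borel_pivot] reduces it to 0 or to a
    basis vector without disturbing T2. *)
Lemma normalizableS p q : normalizable p q -> normalizable p.+1 q.
Proof.
move=> Q; rewrite -addn1 => m M1 M2.
have [l0|l0] := eqVneq (dsubmx M1) 0.
  have [b1 [b2 [A [B1 B2 AU P1 P2]]]] := Q m (usubmx M1) M2.
  exists (block_mx b1 0 0 1%:M), b2, A; split=> //; first exact: borel_ublock.
  rewrite -[M1]vsubmxK l0 mul_block_col !mul0mx mulmx0 !addr0 mul_col_mx mul0mx.
  exact: partial_perm_col0.
case: m M1 M2 l0 => [M1 M2|m]; first by rewrite thinmx0 eqxx.
rewrite -[m.+1]/(1 + m)%N => M1 M2 l0.
have [A0 A0U lA0] := row_to_e1 l0.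
pose N := rsubmx (usubmx M1 *m A0 : 'M_(p, 1 + m)).
pose X := lsubmx (usubmx M1 *m A0 : 'M_(p, 1 + m)).
have M1E : M1 *m A0 = block_mx X N 1%:M 0.
  by rewrite -[M1]vsubmxK mul_col_mx lA0 -[usubmx M1 *m A0]hsubmxK.
pose w0 := lsubmx (M2 *m A0 : 'M_(q, 1 + m)).
pose N2 := rsubmx (M2 *m A0 : 'M_(q, 1 + m)).
have M2E : M2 *m A0 = row_mx w0 N2 by rewrite hsubmxK.
have [b1 [b2 [A [B1 B2 AU P1 P2]]]] := Q m N N2.
(* Adding the combination y of the other columns to the first one clears it
   on the rows occupied by the normal form of N2. *)
have [y y0] := partial_perm_clear (b2 *m w0) P2.
set w := _ + _ in y0.
have [b B [bT bw]] := borel_pivot w.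
have BU : (block_mx 1%:M 0 (A *m y) A : 'M_(1 + m)) \in unitmx.
  by rewrite unitmxE det_lblock det1 mul1r -unitmxE.
exists (block_mx b1 (- (b1 *m (X + N *m (A *m y)))) 0 1%:M), (b *m b2).
exists (A0 *m block_mx 1%:M 0 (A *m y) A); split.
- exact: borel_ublock.
- exact: borelM.
- by rewrite unitmx_mul A0U.
- rewrite -mulmxA (mulmxA M1) M1E !mulmx_block !mulmx1 !mulmx0 !mul0mx !mul1mx.
  rewrite !addr0 !add0r mulmx1 mulmx0 addr0 subrr mulmxA; exact: partial_perm_antiblock.
- rewrite -mulmxA (mulmxA M2) M2E mul_row_block !mulmx1 mulmx0 add0r -mulmxA.
  rewrite !mul_mx_row mulmxDr !(mulmxA b2) (mulmxA (b2 *m N2)) -/w.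
  rewrite (bT _ (b2 *m N2 *m A)) //.
  case: bw => [->|[j wj ->]]; first exact: partial_perm_row0.
  by apply: partial_perm_row_delta => // c; apply: y0.
Qed.

(** The induction step removes a row of the first matrix; exchanging the roles of
    the two matrices reduces the case p = 0 to the same step. *)
Lemma normalizable_all p q : normalizable p q.
Proof.
elim: p => [|p IHp]; last exact: normalizableS.
apply: normalizable_sym; elim: q => [|q IHq]; first exact: normalizable0.
exact: normalizableS.
Qed.

End PartialPermutations.

(** * Orbits of K on X *)

Section Cosets.
Variables (F : fieldType) (p q r : nat).
Local Notation E := (pid_mx r : 'M[F]_(p + q, r)).
Local Notation BK := (@BK_pq F p q).
Local Notation K := (@K_pq F p q).
Local Notation P := (@P_r F p q r).
Local Open Scope classical_set_scope.

Lemma BK_pqP (g : 'M[F]_(p + q)) :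
  BK g <-> exists b1 b2, [/\ borel b1, borel b2 & g = block_mx b1 0 0 b2].
Proof.
split=> [[b1 [b2 [U1 U2 T1 T2 ->]]]|[b1 [b2 [/andP[U1 T1] /andP[U2 T2] ->]]]].
  by exists b1, b2; rewrite /borel U1 U2.
by exists b1, b2.
Qed.

Lemma BK_pq_K (g : 'M[F]_(p + q)) : BK g -> K g.
Proof. by case=> b1 [b2 [U1 U2 _ _ ->]]; exists b1, b2. Qed.

Lemma K_pq_unit (g : 'M[F]_(p + q)) : K g -> g \in unitmx.
Proof.
case=> k1 [k2 [U1 U2 ->]].
by rewrite unitmxE det_ublock unitrM -!unitmxE U1.
Qed.

Lemma K_pqM (g h : 'M[F]_(p + q)) : K g -> K h -> K (g *m h).
Proof.
case=> k1 [k2 [U1 U2 ->]] [l1 [l2 [V1 V2 ->]]]; exists (k1 *m l1), (k2 *m l2).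
by rewrite !unitmx_mul U1 U2 mulmx_block !mulmx0 !mul0mx !addr0 add0r.
Qed.

Lemma invmx_bdiag (k1 : 'M[F]_p) (k2 : 'M[F]_q) :
  k1 \in unitmx -> k2 \in unitmx ->
  invmx (block_mx k1 0 0 k2) = block_mx (invmx k1) 0 0 (invmx k2).
Proof.
move=> U1 U2; have U : block_mx k1 0 0 k2 \in unitmx.
  by apply: K_pq_unit; exists k1, k2.
apply: (can_inj (mulKmx U)); rewrite mulmxV // mulmx_block.
by rewrite !mulmx0 !mul0mx !addr0 add0r !mulmxV // -scalar_mx_block.
Qed.

Lemma K_pqV (g : 'M[F]_(p + q)) : K g -> K (invmx g).
Proof.
case=> k1 [k2 [U1 U2 ->]]; exists (invmx k1), (invmx k2).
by rewrite !unitmx_inv invmx_bdiag.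
Qed.

Lemma K_pq1 : K 1%:M.
Proof. by exists 1%:M, 1%:M; rewrite !unitmx1 -scalar_mx_block. Qed.

Lemma BK_pq1 : BK 1%:M.
Proof.
by apply/BK_pqP; exists 1%:M, 1%:M; rewrite !borel1 -scalar_mx_block.
Qed.

Lemma lmulset_mul (g h : 'M[F]_(p + q)) (A : set 'M[F]_(p + q)) :
  lmulset g (lmulset h A) = lmulset (g *m h) A.
Proof.
apply/seteqP; split=> [_ [_ [x Ax <-] <-]|_ [x Ax <-]].
  by exists x; rewrite ?mulmxA.
by exists (h *m x); [exists x | rewrite mulmxA].
Qed.

Lemma lmulset1 (A : set 'M[F]_(p + q)) : lmulset 1%:M A = A.
Proof. by rewrite /lmulset; under eq_imagel do rewrite mul1mx; exact: image_id. Qed.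

Lemma lmulset_BK (b : 'M[F]_(p + q)) : BK b -> lmulset b BK = BK.
Proof.
have BKM g h : BK g -> BK h -> BK (g *m h).
  move=> /BK_pqP[b1 [b2 [B1 B2 ->]]] /BK_pqP[c1 [c2 [C1 C2 ->]]].
  apply/BK_pqP; exists (b1 *m c1), (b2 *m c2).
  by rewrite !borelM // mulmx_block !mulmx0 !mul0mx !addr0 add0r.
move=> Bb; apply/seteqP; split=> [_ [x Bx <-]|x Bx]; first exact: BKM.
exists (invmx b *m x); last by rewrite mulKVmx // K_pq_unit //; apply: BK_pq_K.
apply: BKM => //; have /BK_pqP[b1 [b2 [B1 B2 ->]]] := Bb.
apply/BK_pqP; exists (invmx b1), (invmx b2); rewrite !borelV //.
by rewrite invmx_bdiag //; [case/borelP: B1 | case/borelP: B2].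
Qed.

(** Translating by K allows the first component of a point of X to be moved to
    the base point of K/B_K, whose stabilizer is B_K: K-orbits on X are
    B_K-orbits on G/P. *)
Lemma K_orbit_lmulset (k : 'M[F]_(p + q)) (A B : set 'M[F]_(p + q)) :
  K k -> K_orbit (lmulset k A, lmulset k B) = K_orbit (A, B).
Proof.
move=> Kk; apply/seteqP; split=> [_ [h Kh <-]|_ [h Kh <-]] /=.
  by exists (h *m k); [exact: K_pqM | rewrite /= !lmulset_mul].
exists (h *m invmx k); first by apply: K_pqM => //; apply: K_pqV.
by rewrite /= !lmulset_mul mulmxKV // K_pq_unit.
Qed.

Lemma pid_mul_eq0 m (D : 'M[F]_(r, m)) (i : 'I_(p + q)) j :
  (r <= i)%N -> (E *m D) i j = 0.
Proof.
move=> le_ri; rewrite mxE big1 // => l _.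
by rewrite mxE ltnNge le_ri andbF mul0r.
Qed.

Lemma mul_pidE (le_rn : (r <= p + q)%N) (M : 'M[F]_(p + q)) i (j : 'I_r) :
  (M *m E) i j = M i (widen_ord le_rn j).
Proof.
rewrite mxE (bigD1 (widen_ord le_rn j)) //= mxE /= eqxx ltn_ord mulr1.
rewrite big1 ?addr0 // => l ne_lj; rewrite mxE.
by rewrite (negPf (_ : l != j :> nat)) ?mulr0.
Qed.

(** P is the stabilizer of the span of the first r basis vectors. *)
Lemma parabolicP (le_rn : (r <= p + q)%N) (x : 'M[F]_(p + q)) :
  P x <-> x \in unitmx /\ ((x *m E)^T :=: E^T)%MS.
Proof.
split=> -[xU xE]; split=> //; last first.
  move=> i j lt_jr le_ri.
  have /submxP[D defD] : ((x *m E)^T <= E^T)%MS by rewrite xE.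
  rewrite (_ : j = widen_ord le_rn (Ordinal lt_jr)); last exact/val_inj.
  rewrite -mul_pidE -[x *m E]trmxK defD trmx_mul trmxK.
  exact: pid_mul_eq0.
apply/eqmxP; rewrite -(mxrank_leqif_eq _).2.
  by rewrite !mxrank_tr eqmxMfull // row_full_unit.
rewrite (_ : x *m E = E *m (E^T *m (x *m E))).
  by rewrite trmx_mul submxMl.
have Eil (i : 'I_(p + q)) (l : 'I_r) : E i l = (i == l :> nat)%:R.
  by rewrite mxE; case: eqP => //= ->; rewrite ltn_ord.
apply/matrixP=> i j; have [lt_ir|le_ri] := ltnP i r; last first.
  by rewrite pid_mul_eq0 // (mul_pidE le_rn) xE //= ltn_ord.
rewrite [RHS]mxE (bigD1 (Ordinal lt_ir)) //= big1 ?addr0 => [|l ne_li].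
  rewrite Eil eqxx mul1r [RHS]mxE (bigD1 i) //= big1 ?addr0 => [|l ne_li].
    by rewrite [E^T _ _]mxE Eil eqxx mul1r.
  by rewrite [E^T _ _]mxE Eil (negPf (_ : l != i :> nat)) ?mul0r.
by rewrite Eil eq_sym (negPf (_ : l != i :> nat)) ?mul0r.
Qed.

Lemma lmulset_P (g : 'M[F]_(p + q)) : (r <= p + q)%N -> g \in unitmx ->
  lmulset g P = span_coset (g *m E).
Proof.
move=> le_rn gU; apply/seteqP; split=> [_ [x /(parabolicP le_rn)[xU xE] <-]|y [yU yE]].
  split; first by rewrite unitmx_mul gU.
  by rewrite -mulmxA !(trmx_mul g); apply: eqmxMr.
exists (invmx g *m y); last by rewrite mulKVmx.
apply/(parabolicP le_rn); split; first by rewrite unitmx_mul unitmx_inv gU.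
rewrite -mulmxA trmx_mul; apply: eqmx_trans (eqmxMr _ yE) _.
by rewrite -trmx_mul mulKmx.
Qed.

Lemma span_coset_eqmx (M N : 'M[F]_(p + q, r)) :
  (M^T :=: N^T)%MS -> span_coset M = span_coset N.
Proof.
move=> MN; apply/seteqP; split=> g [gU gM]; split=> //.
  exact: eqmx_trans gM MN.
exact: eqmx_trans gM (eqmx_sym MN).
Qed.

Lemma lmulset_span (h : 'M[F]_(p + q)) (M : 'M[F]_(p + q, r)) :
  h \in unitmx -> lmulset h (span_coset M) = span_coset (h *m M).
Proof.
move=> hU; apply/seteqP; split=> [_ [x [xU xM] <-]|y [yU yM]].
  split; first by rewrite unitmx_mul hU.
  by rewrite -mulmxA !(trmx_mul h); apply: eqmxMr.
exists (invmx h *m y); last by rewrite mulKVmx.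
split; first by rewrite unitmx_mul unitmx_inv hU.
rewrite -mulmxA trmx_mul; apply: eqmx_trans (eqmxMr _ yM) _.
by rewrite -trmx_mul mulKmx.
Qed.

Lemma span_coset_inj (M N : 'M[F]_(p + q, r)) :
  \rank M = r -> span_coset M = span_coset N -> (M^T :=: N^T)%MS.
Proof.
move=> rM MN; have [g gU gM] := span_cosetP rM.
have : span_coset M g.
  rewrite -gM; exists 1%:M; last by rewrite mulmx1.
  split=> [|i j lt_jr le_ri]; first exact: unitmx1.
  rewrite mxE (_ : (i == j) = false) //; apply/negbTE.
  by rewrite -val_eqE /= neq_ltn (leq_trans lt_jr) ?orbT.
move=> Mg; have Ng := Mg; rewrite MN in Ng.
case: Mg Ng => _ gM' [_ gN]; exact: eqmx_trans (eqmx_sym gM') gN.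
Qed.

Lemma tau_rank (tau : tau_mx F p q r) : \rank tau = r.
Proof. by case/and3P: (tau_valP tau) => /eqP. Qed.

Lemma tau_orbit_eqmx (tau tau' : tau_mx F p q r) :
  (tau^T :=: tau'^T)%MS -> tau_orbit tau = tau_orbit tau'.
Proof.
move=> E; apply: val_inj => /=.
by rewrite (span_coset_eqmx E).
Qed.

(** An element of K which fixes the base point of K/B_K lies in B_K. *)
Lemma tau_orbit_eqP (tau tau' : tau_mx F p q r) :
  tau_orbit tau = tau_orbit tau' ->
  exists2 h, BK h & ((h *m tau)^T :=: tau'^T)%MS.
Proof.
move/(congr1 val) => /= tt'.
have : K_orbit (BK, span_coset tau') (BK, span_coset tau').
  by exists 1%:M; [exact: K_pq1 | rewrite /= !lmulset1].
rewrite -tt' => -[h Kh] /= [hB ht]; exists h.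
  by rewrite -hB; exists 1%:M; [exact: BK_pq1 | rewrite mulmx1].
have hU := K_pq_unit Kh; apply: span_coset_inj; last by rewrite -lmulset_span.
by rewrite eqmxMfull ?tau_rank // row_full_unit.
Qed.

(** A representative (hB, gP) is moved to (B, h^-1 g P), and h^-1 g P is the
    span of the first r columns of h^-1 g, which [normalizable_all] brings to
    the required form. *)
Lemma tau_orbit_surj (o : @K_orbits F p q r) : (r <= p + q)%N ->
  exists tau : tau_mx F p q r, tau_orbit tau = o.
Proof.
move=> le_rn; case: o => o oP.
have := set_mem oP; case=> -[A B] /= [/= [h Kh hA] [g gU gB]] oE.
pose M := invmx h *m g *m E.
have hU := K_pq_unit Kh.
have [b1 [b2 [A' [B1 B2 AU P1 P2]]]] := normalizable_all (usubmx M) (dsubmx M).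
pose b := block_mx b1 0 0 b2; have Bb : BK b by apply/BK_pqP; exists b1, b2.
have bU := K_pq_unit (BK_pq_K Bb).
have bM : b *m M *m A' = col_mx (b1 *m usubmx M *m A') (b2 *m dsubmx M *m A').
  by rewrite -{1}[M]vsubmxK mul_block_col !mul0mx addr0 add0r mul_col_mx.
have rM : \rank M = r.
  by rewrite eqmxMfull ?rank_pid_mx // row_full_unit unitmx_mul unitmx_inv hU.
have tP : [&& \rank (b *m M *m A') == r, is_partial_perm (usubmx (b *m M *m A'))
               & is_partial_perm (dsubmx (b *m M *m A'))].
  rewrite {2 3}bM col_mxKu col_mxKd P1 P2 !andbT -mxrank_tr trmx_mul.
  rewrite eqmxMfull ?row_full_unit ?unitmx_tr // mxrank_tr eqmxMfull ?rM //.
  by rewrite row_full_unit.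
exists (TauMx tP); apply: val_inj => /=.
rewrite -oE -hA -gB -(K_orbit_lmulset (lmulset h _) _ (K_pqV Kh)) !lmulset_mul mulVmx //.
rewrite lmulset1 lmulset_P ?unitmx_mul ?unitmx_inv ?hU //.
rewrite -(K_orbit_lmulset BK (span_coset M) (BK_pq_K Bb)) lmulset_BK // lmulset_span //.
congr (K_orbit (_, _)); apply: span_coset_eqmx; rewrite trmx_mul.
by apply: eqmxMfull; rewrite row_full_unit unitmx_tr.
Qed.

End Cosets.

(** * Ranks and tail sums *)

Section DisjointColumns.
Variable F : fieldType.

(** The nonzero columns are linearly independent as their supports are disjoint:
    a left inverse is obtained by choosing one nonzero entry in each of them. *)
Lemma rank_disjoint_cols n m (A : 'M[F]_(n, m)) :
  (forall i c c', A i c != 0 -> A i c' != 0 -> c = c') ->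
  \rank A = #|[pred c | [exists i, A i c != 0]]|.
Proof.
move=> Ar; set S := [pred c | _].
have /fin_all_exists[g gP] (k : 'I_#|S|) : exists i, A i (enum_val k) != 0.
  by have /existsP := enum_valP k.
pose N := colsub (@enum_val _ S) (1%:M : 'M[F]_m).
have AN : A *m N = colsub (@enum_val _ S) A.
  apply/matrixP=> i k; rewrite !mxE (bigD1 (enum_val k)) //= !mxE eqxx mulr1.
  by rewrite big1 ?addr0 // => c /negPf ne_c; rewrite !mxE ne_c mulr0.
apply/eqP; rewrite eqn_leq; apply/andP; split.
  rewrite (_ : A = A *m N *m N^T).
    apply: leq_trans (mxrankM_maxl _ _) _; exact: rank_leq_col.
  apply/matrixP=> i c; rewrite AN mxE.
  under eq_bigr do rewrite !mxE.
  rewrite -(big_enum_val (fun c' => A i c' * (c == c')%:R)) /=.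
  case Ac: (A i c == 0).
    rewrite (eqP Ac) big1 // => c' _; case: eqP => [<-|_]; last by rewrite mulr0.
    by rewrite (eqP Ac) mul0r.
  rewrite (bigD1 c) /=; last by apply/existsP; exists i; rewrite Ac.
  rewrite eqxx mulr1 big1 ?addr0 // => c' /andP[_ /negPf ne_c].
  by rewrite eq_sym ne_c mulr0.
pose B : 'M[F]_(#|S|, n) := \matrix_(k, i) ((A i (enum_val k))^-1 *+ (i == g k)).
apply: (@mulmx1_min_rank _ _ _ _ _ B N); rewrite -mulmxA AN.
apply/matrixP=> k l; rewrite !mxE (bigD1 (g k)) //= !mxE eqxx mulr1n.
rewrite big1 ?addr0 => [|i /negPf ne_i]; last by rewrite !mxE ne_i mul0r.
have [->|ne_kl] := eqVneq k l; first by rewrite mulVf.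
case: (eqVneq (A (g k) (enum_val l)) 0) => [->|gl]; first by rewrite mulr0.
by rewrite (enum_val_inj (Ar _ _ _ (gP k) gl)) eqxx in ne_kl.
Qed.

End DisjointColumns.

Section Counting.

Lemma sum_unique (I : finType) (P : pred I) :
  (forall x y, P x -> P y -> x = y) -> (\sum_i P i)%N = [exists i, P i].
Proof.
move=> Pu; case: existsP => [[x Px]|nP].
  rewrite (bigD1 x) //= Px big1 // => y ne_y.
  by case Py: (P y) => //; rewrite (Pu _ _ Py Px) eqxx in ne_y.
by rewrite big1 // => x _; case Px: (P x) => //; case: nP; exists x.
Qed.

(** Each value is the difference of two consecutive tail sums. *)
Lemma eq_tail_sums n (f g : 'I_n -> nat) :
  (forall i : nat,
     \sum_(a : 'I_n | i <= a) f a = \sum_(a : 'I_n | i <= a) g a)%N ->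
  f =1 g.
Proof.
move=> fg a.
have tail (h : 'I_n -> nat) :
    (\sum_(b : 'I_n | a <= b) h b = h a + \sum_(b : 'I_n | a < b) h b)%N.
  rewrite (bigD1 a) //=; congr addn; apply: eq_bigl => b.
  by rewrite ltn_neqAle andbC eq_sym.
by have := fg a; rewrite !tail fg => /addIn.
Qed.

End Counting.

(** * The pattern of a matrix is an invariant of its orbit *)

Section Invariants.
Variables (F : fieldType) (p q r : nat).
Implicit Types tau : tau_mx F p q r.

Definition top tau a c : bool := tau (lshift q a) c != 0.
Definition bot tau b c : bool := tau (rshift p b) c != 0.

Definition top_occ tau a := [exists c, top tau a c].
Definition bot_occ tau b := [exists c, bot tau b c].
Definition linked tau a b := [exists c, top tau a c && bot tau b c].

Lemma tau_partial_perm tau :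
  is_partial_perm (usubmx tau) /\ is_partial_perm (dsubmx tau).
Proof. by case/and3P: (tau_valP tau). Qed.

Lemma tau_topE tau a c : tau (lshift q a) c = (top tau a c)%:R.
Proof.
have [/partial_permP[/(_ a c) + _ _] _] := tau_partial_perm tau.
by rewrite mxE.
Qed.

Lemma tau_botE tau b c : tau (rshift p b) c = (bot tau b c)%:R.
Proof.
have [_ /partial_permP[/(_ b c) + _ _]] := tau_partial_perm tau.
by rewrite mxE.
Qed.

Lemma top_col_inj tau a c c' : top tau a c -> top tau a c' -> c = c'.
Proof.
have [/partial_permP[_ /(_ a c c') + _] _] := tau_partial_perm tau.
by rewrite !mxE.
Qed.

Lemma top_row_inj tau a a' c : top tau a c -> top tau a' c -> a = a'.
Proof.
have [/partial_permP[_ _ /(_ a a' c)] + _] := tau_partial_perm tau.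
by rewrite !mxE.
Qed.

Lemma bot_col_inj tau b c c' : bot tau b c -> bot tau b c' -> c = c'.
Proof.
have [_ /partial_permP[_ /(_ b c c') + _]] := tau_partial_perm tau.
by rewrite !mxE.
Qed.

Lemma bot_row_inj tau b b' c : bot tau b c -> bot tau b' c -> b = b'.
Proof.
have [_ /partial_permP[_ _ /(_ b b' c)]] := tau_partial_perm tau.
by rewrite !mxE.
Qed.

Lemma tau_col_inj tau i c c' : tau i c != 0 -> tau i c' != 0 -> c = c'.
Proof.
by case: (split_ordP i) => j ->; [exact: top_col_inj | exact: bot_col_inj].
Qed.

(** The number of columns not contained in the B_K-stable subspace spanned by the
    first i basis vectors of F^p and the first j basis vectors of F^q. *)
Definition tail_cols tau i j :=
  (\sum_c ([exists a : 'I_p, (i <= a)%N && top tau a c] ||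
           [exists b : 'I_q, (j <= b)%N && bot tau b c]))%N.

(** The projection of F^p + F^q along the span of the first i basis vectors of F^p
    and the first j basis vectors of F^q. *)
Definition tail_proj i j : 'M[F]_(p + q) :=
  diag_mx (\row_l (match fintype.split l with
                   | inl a => (i <= a)%N | inr b => (j <= b)%N end)%:R).

Lemma split_lshift (a : 'I_p) : fintype.split (lshift q a) = inl a.
Proof. by rewrite -[lshift q a]/(unsplit (inl a)) unsplitK. Qed.
Lemma split_rshift (b : 'I_q) : fintype.split (rshift p b) = inr b.
Proof. by rewrite -[rshift p b]/(unsplit (inr b)) unsplitK. Qed.

Lemma tail_proj_top i j m (M : 'M[F]_(p + q, m)) a c :
  (tail_proj i j *m M) (lshift q a) c = M (lshift q a) c *+ (i <= a)%N.
Proof. by rewrite mul_diag_mx !mxE split_lshift mulr_natl. Qed.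

Lemma tail_proj_bot i j m (M : 'M[F]_(p + q, m)) b c :
  (tail_proj i j *m M) (rshift p b) c = M (rshift p b) c *+ (j <= b)%N.
Proof. by rewrite mul_diag_mx !mxE split_rshift mulr_natl. Qed.

Lemma rank_tail_proj tau i j : \rank (tail_proj i j *m tau) = tail_cols tau i j.
Proof.
have bE (b : bool) (x : F) : (x *+ b != 0) = b && (x != 0).
  by case: b; rewrite ?mulr0n ?eqxx.
rewrite rank_disjoint_cols => [|l c c'].
  rewrite /tail_cols -sum1_card big_mkcond /=; apply: eq_bigr => c _.
  rewrite inE (_ : [exists l, _] = [exists a : 'I_p, (i <= a)%N && top tau a c] ||
           [exists b : 'I_q, (j <= b)%N && bot tau b c]); first by case: orb.
  apply/existsP/orP => [[l]|[] /existsP[l lP]].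
  - case: (split_ordP l) => k ->; rewrite ?tail_proj_top ?tail_proj_bot bE => kP.
      by left; apply/existsP; exists k.
    by right; apply/existsP; exists k.
  - by exists (lshift q l); rewrite tail_proj_top bE.
  - by exists (rshift p l); rewrite tail_proj_bot bE.
case: (split_ordP l) => k ->; rewrite ?tail_proj_top ?tail_proj_bot !bE;
  move=> /andP[_ +] /andP[_ +]; [exact: top_col_inj | exact: bot_col_inj].
Qed.

Lemma tail_cols_rank tau : tail_cols tau 0 0 = r.
Proof.
rewrite -rank_tail_proj -[RHS](tau_rank tau); congr (\rank _).
apply/matrixP=> l c.
by case: (split_ordP l) => k ->; rewrite ?tail_proj_top ?tail_proj_bot mulr1n.
Qed.

(** Inclusion-exclusion: a column meets the two tails, one of them or none, and
    it meets each tail at most once. *)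
Lemma tail_cols_sum tau i j :
  (tail_cols tau i j
     + \sum_(a : 'I_p | i <= a) \sum_(b : 'I_q | j <= b) linked tau a b
   = \sum_(a : 'I_p | i <= a) top_occ tau a
     + \sum_(b : 'I_q | j <= b) bot_occ tau b)%N.
Proof.
have topE a : (top_occ tau a : nat) = (\sum_c top tau a c)%N.
  by rewrite sum_unique // => c c'; apply: top_col_inj.
have botE b : (bot_occ tau b : nat) = (\sum_c bot tau b c)%N.
  by rewrite sum_unique // => c c'; apply: bot_col_inj.
have linkE a b : (linked tau a b : nat) = (\sum_c top tau a c * bot tau b c)%N.
  under eq_bigr do rewrite mulnb.
  by rewrite sum_unique // => c c' /andP[+ _] /andP[+ _]; apply: top_col_inj.
under [X in (_ + X = _)%N]eq_bigr => a _ do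
  (under eq_bigr => b _ do rewrite linkE; rewrite exchange_big /=).
under [X in (_ = X + _)%N]eq_bigr => a _ do rewrite topE.
under [X in (_ = _ + X)%N]eq_bigr => b _ do rewrite botE.
rewrite exchange_big [X in (_ = X + _)%N]exchange_big.
rewrite [X in (_ = _ + X)%N]exchange_big /tail_cols -!big_split /=.
apply: eq_bigr => c _; rewrite -big_distrlr /=.
have -> : (\sum_(a : 'I_p | i <= a) top tau a c)%N
          = [exists a : 'I_p, (i <= a)%N && top tau a c].
  rewrite -sum_unique => [|a a' /andP[_ +] /andP[_ +]]; last exact: top_row_inj.
  by rewrite big_mkcond; apply: eq_bigr => a _; case: (i <= a)%N.
have -> : (\sum_(b : 'I_q | j <= b) bot tau b c)%N
          = [exists b : 'I_q, (j <= b)%N && bot tau b c].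
  rewrite -sum_unique => [|a a' /andP[_ +] /andP[_ +]]; last exact: bot_row_inj.
  by rewrite big_mkcond; apply: eq_bigr => a _; case: (j <= a)%N.
by do 2!case: [exists _, _].
Qed.

Definition same_pattern tau tau' :=
  [/\ top_occ tau =1 top_occ tau', bot_occ tau =1 bot_occ tau'
    & linked tau =2 linked tau'].

Lemma same_pattern_sym tau tau' : same_pattern tau tau' -> same_pattern tau' tau.
Proof. by case=> tE bE lE; split=> [a|b|a b]; rewrite ?tE ?bE ?lE. Qed.

(** Taking an empty tail in one block isolates the occupied rows of the other
    one; the remaining term is a double tail sum of the linking relation. *)
Lemma tail_cols_inj tau tau' :
  (forall i j, tail_cols tau i j = tail_cols tau' i j) -> same_pattern tau tau'.
Proof.
move=> tt'.
have top_eq : top_occ tau =1 top_occ tau'.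
  suff eq_nat : (fun a => top_occ tau a : nat) =1 (fun a => top_occ tau' a : nat).
    by move=> a; have := eq_nat a; do 2!case: top_occ.
  apply: eq_tail_sums => i.
  have := tail_cols_sum tau i q; have := tail_cols_sum tau' i q; rewrite tt'.
  have no_b (f : 'I_q -> nat) : (\sum_(b : 'I_q | q <= b) f b = 0)%N.
    by rewrite big_pred0 // => b; rewrite leqNgt ltn_ord.
  rewrite !no_b !addn0; under eq_bigr do rewrite no_b.
  by under [in X in _ -> X -> _]eq_bigr do rewrite no_b; move=> -> ->.
have bot_eq : bot_occ tau =1 bot_occ tau'.
  suff eq_nat : (fun a => bot_occ tau a : nat) =1 (fun a => bot_occ tau' a : nat).
    by move=> a; have := eq_nat a; do 2!case: bot_occ.
  apply: eq_tail_sums => j.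
  have := tail_cols_sum tau p j; have := tail_cols_sum tau' p j; rewrite tt'.
  have no_a (f : 'I_p -> nat) : (\sum_(b : 'I_p | p <= b) f b = 0)%N.
    by rewrite big_pred0 // => b; rewrite leqNgt ltn_ord.
  by rewrite !no_a !addn0 !add0n => -> ->.
split=> // a b.
suff eq_nat : (fun b => linked tau a b : nat) =1 (fun b => linked tau' a b : nat).
  by have := eq_nat b; do 2!case: linked.
apply: eq_tail_sums => j; move: a.
suff eq_nat : (fun a => \sum_(b : 'I_q | (j <= b)%N) linked tau a b)%N =1
              (fun a => \sum_(b : 'I_q | (j <= b)%N) linked tau' a b)%N.
  by move=> a; apply: eq_nat.
apply: eq_tail_sums => i.
have := tail_cols_sum tau i j; have := tail_cols_sum tau' i j; rewrite tt'.
have topS : (\sum_(a : 'I_p | i <= a) top_occ tau a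
             = \sum_(a : 'I_p | i <= a) top_occ tau' a)%N.
  by apply: eq_bigr => k _; rewrite top_eq.
have botS : (\sum_(b : 'I_q | j <= b) bot_occ tau b
             = \sum_(b : 'I_q | j <= b) bot_occ tau' b)%N.
  by apply: eq_bigr => k _; rewrite bot_eq.
by rewrite topS botS => <- /addnI.
Qed.

(** The kernel of the projection is stable under B_K. *)
Lemma tail_proj_BK i j (h : 'M[F]_(p + q)) : BK_pq h ->
  tail_proj i j *m h = tail_proj i j *m h *m tail_proj i j.
Proof.
case/BK_pqP=> b1 [b2 [/borelP[_ T1] /borelP[_ T2] ->]].
apply/matrixP=> l m.
rewrite {2}[tail_proj i j]/tail_proj mul_mx_diag [RHS]mxE [X in _ = _ * X]mxE.
rewrite -/(tail_proj i j).
case: (split_ordP l) => {}l ->; case: (split_ordP m) => {}m ->;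
  rewrite ?tail_proj_top ?tail_proj_bot ?split_lshift ?split_rshift.
- rewrite block_mxEul; have [lt_ml|le_lm] := ltnP m l.
    by rewrite T1 // mul0rn mul0r.
  case: (leqP i l) => [le_il|]; last by rewrite mul0r.
  by rewrite (leq_trans le_il le_lm) mulr1.
- by rewrite block_mxEur mxE mul0rn mul0r.
- by rewrite block_mxEdl mxE mul0rn mul0r.
- rewrite block_mxEdr; have [lt_ml|le_lm] := ltnP m l.
    by rewrite T2 // mul0rn mul0r.
  case: (leqP j l) => [le_il|]; last by rewrite mul0r.
  by rewrite (leq_trans le_il le_lm) mulr1.
Qed.

(** Only an inequality, as [tau_orbit_eqP] gives one element of B_K; the
    opposite one follows by exchanging tau and tau'. *)
Lemma tail_cols_le tau tau' i j :
  tau_orbit tau = tau_orbit tau' -> (tail_cols tau' i j <= tail_cols tau i j)%N.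
Proof.
case/tau_orbit_eqP=> h Bh ht; rewrite -!rank_tail_proj.
rewrite -mxrank_tr trmx_mul -(eqmxMr _ ht) -trmx_mul mxrank_tr mulmxA.
by rewrite tail_proj_BK // -(mulmxA _ _ tau); exact: mxrankM_maxr.
Qed.

(** Every column of tau is also a column of tau': pick a nonzero entry of it;
    the column of tau' through the same row has the same entries, since the
    rest of a column is determined by one of its rows and the linking relation.
    Columns of tau are nonzero because tau has rank r. *)
Lemma same_pattern_submx tau tau' :
  same_pattern tau tau' -> (tau^T <= tau'^T)%MS.
Proof.
case=> tE bE lE; apply/row_subP=> c.
suff [c' cc'] : exists c', row c tau^T = row c' tau'^T by rewrite cc' row_sub.
suff [c' [tt' bb']] : exists c', (forall a, top tau a c = top tau' a c') /\
                        (forall b, bot tau b c = bot tau' b c').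
  exists c'; apply/rowP=> l; rewrite !mxE.
  by case: (split_ordP l) => k ->; rewrite ?tau_topE ?tau_botE ?tt' ?bb'.
have linkedEt t a b c1 : top t a c1 -> linked t a b = bot t b c1.
  move=> ac; apply/existsP/idP=> [[c0 /andP[ac0 bc0]]|bc]; last first.
    by exists c1; rewrite ac.
  by rewrite (top_col_inj ac ac0).
have linkedEb t a b c1 : bot t b c1 -> linked t a b = top t a c1.
  move=> bc; apply/existsP/idP=> [[c0 /andP[ac0 bc0]]|ac]; last first.
    by exists c1; rewrite ac.
  by rewrite (bot_col_inj bc bc0).
have rowEt t a a' c1 : top t a c1 -> top t a' c1 = (a' == a).
  move=> ac; apply/idP/eqP=> [a'c|->//]; exact: top_row_inj a'c ac.
have rowEb t b b' c1 : bot t b c1 -> bot t b' c1 = (b' == b).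
  move=> bc; apply/idP/eqP=> [b'c|->//]; exact: bot_row_inj b'c bc.
have [l lc] : exists l, tau l c != 0.
  have := tau_rank tau; rewrite (rank_disjoint_cols (@tau_col_inj tau)) => rE.
  apply/existsP; apply: contraT => nc.
  suff: (#|[pred c0 | [exists i, tau i c0 != 0%R]]| < #|'I_r|)%N.
    by rewrite rE card_ord ltnn.
  apply: proper_card; apply/properP; split; first exact/fintype.subsetP.
  by exists c => //; rewrite inE.
case: (split_ordP l) lc => k -> kc.
  have kct : top tau k c by [].
  have : top_occ tau k by apply/existsP; exists c.
  rewrite tE => /existsP[c' kc']; exists c'; split=> [a|b].
    by rewrite (rowEt _ _ _ _ kct) (rowEt _ _ _ _ kc').
  by rewrite -(linkedEt _ _ _ _ kct) -(linkedEt _ _ _ _ kc').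
have kcb : bot tau k c by [].
have : bot_occ tau k by apply/existsP; exists c.
rewrite bE => /existsP[c' kc']; exists c'; split=> [a|b].
  by rewrite -(linkedEb _ _ _ _ kcb) -(linkedEb _ _ _ _ kc').
by rewrite (rowEb _ _ _ _ kcb) (rowEb _ _ _ _ kc').
Qed.

Lemma tau_orbitE tau tau' :
  tau_orbit tau = tau_orbit tau' <-> same_pattern tau tau'.
Proof.
split=> [tt'|tt']; last first.
  apply: tau_orbit_eqmx; apply/eqmxP.
  by rewrite !same_pattern_submx //; apply: same_pattern_sym.
apply: tail_cols_inj => i j; apply/eqP.
by rewrite eqn_leq !tail_cols_le.
Qed.

End Invariants.

(** * Permutations preserving blocks *)

Section PermutationsOfBlocks.

(** A list without repetition is completed to an enumeration by appending the
    missing elements. *)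
Lemma perm_of_uniq n (L : seq 'I_n) : uniq L ->
  exists u : 'S_n,
    (forall (i : 'I_n) x0, (i < size L)%N -> u i = nth x0 L i) /\
    (forall i : 'I_n, (u i \in L) = (i < size L)%N).
Proof.
move=> uL; pose L' := L ++ [seq i <- enum 'I_n | i \notin L].
have uL' : uniq L'.
  rewrite cat_uniq uL filter_uniq ?enum_uniq // andbT.
  by apply/hasPn=> i; rewrite mem_filter => /andP[].
have sL' : size L' = n.
  rewrite -[RHS]card_ord -(card_uniqP uL'); apply: eq_card => i.
  by rewrite mem_cat mem_filter mem_enum !inE andbT orbN.
have fI : injective (fun i : 'I_n => nth i L' i).
  move=> i j; rewrite (set_nth_default j) ?sL' // => /eqP.
  by rewrite nth_uniq ?sL' // => /eqP/val_inj.
exists (perm fI); split=> [i x0 lt_i|i]; rewrite permE.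
  by rewrite nth_cat lt_i; apply: set_nth_default.
rewrite nth_cat; case: ltnP => [lt_i|le_i]; first exact: mem_nth.
have : nth i [seq i <- enum 'I_n | i \notin L] (i - size L)
         \in [seq i <- enum 'I_n | i \notin L].
  apply: mem_nth; rewrite -(ltn_add2l (size L)) subnKC // -size_cat.
  by rewrite -/L' sL'.
by rewrite mem_filter => /andP[/negPf].
Qed.

Lemma acts_on_block_exists n m d (u : 'S_n) : (d + m <= n)%N ->
  (forall i : 'I_n, (d <= i < d + m)%N -> (d <= u i < d + m)%N) ->
  exists a : 'S_m, acts_on_block d u a.
Proof.
move=> le_n ub.
have inb (j : 'I_m) : (d + j < n)%N.
  by apply: leq_trans le_n; rewrite ltn_add2l.
pose e (j : 'I_m) : 'I_n := Ordinal (inb j).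
have eb j : (d <= u (e j) < d + m)%N.
  by apply: ub; rewrite /= leq_addr ltn_add2l ltn_ord.
have fb j : (u (e j) - d < m)%N.
  by have /andP[le_d lt_m] := eb j; rewrite -(ltn_add2l d) subnKC.
have fI : injective (fun j => Ordinal (fb j)).
  move=> j j' /(congr1 val) /= /(congr1 (addn d)).
  have /andP[le_d _] := eb j; have /andP[le_d' _] := eb j'.
  rewrite !subnKC // => /val_inj/perm_inj/(congr1 val) /= /addnI; exact: val_inj.
exists (perm fI); apply/acts_on_blockP=> i j ij.
have -> : i = e j by apply: val_inj.
by rewrite permE /= subnKC //; have /andP[] := eb j.
Qed.

Lemma acts_on_block_range n m d (u : 'S_n) (a : 'S_m) (i : 'I_n) :
  acts_on_block d u a -> (d <= i < d + m)%N -> (d <= u i < d + m)%N.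
Proof.
move=> /acts_on_blockP ua /andP[le_d lt_m].
have lt_j : (i - d < m)%N by rewrite -(ltn_add2l d) subnKC.
rewrite (ua i (Ordinal lt_j)) /= ?subnKC //.
by rewrite leq_addr ltn_add2l ltn_ord.
Qed.

Lemma block_bounds n k s (i j : nat) : (k + s <= n)%N -> (i < n)%N ->
  ((0 <= i < 0 + k)%N -> (0 <= j < 0 + k)%N) ->
  ((k <= i < k + s)%N -> (k <= j < k + s)%N) ->
  ((k + s <= i < k + s + (n - k - s))%N ->
   (k + s <= j < k + s + (n - k - s))%N) ->
  (j < k)%N = (i < k)%N /\ (j < k + s)%N = (i < k + s)%N.
Proof. by move=> *; lia. Qed.

End PermutationsOfBlocks.

(** * Standard patterns and their stabilizers *)

Section StandardPatterns.
Variables (F : fieldType) (p q r : nat).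
Implicit Types (tau : tau_mx F p q r) (w : 'S_p * 'S_q).

Lemma top_W_tau w tau a c : top (W_tau w tau) a c = top tau (w.1 a) c.
Proof.
rewrite /top /= -[X in _ *m X]vsubmxK mul_block_col mul0mx addr0 col_mxEu.
by rewrite -row_permE !mxE.
Qed.

Lemma bot_W_tau w tau b c : bot (W_tau w tau) b c = bot tau (w.2 b) c.
Proof.
rewrite /bot /= -[X in _ *m X]vsubmxK mul_block_col !mul0mx add0r col_mxEd.
by rewrite -row_permE !mxE.
Qed.

Lemma top_occ_W_tau w tau a : top_occ (W_tau w tau) a = top_occ tau (w.1 a).
Proof. by apply: eq_existsb => c; rewrite top_W_tau. Qed.

Lemma bot_occ_W_tau w tau b : bot_occ (W_tau w tau) b = bot_occ tau (w.2 b).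
Proof. by apply: eq_existsb => c; rewrite bot_W_tau. Qed.

Lemma linked_W_tau w tau a b :
  linked (W_tau w tau) a b = linked tau (w.1 a) (w.2 b).
Proof. by apply: eq_existsb => c; rewrite top_W_tau bot_W_tau. Qed.

Lemma same_pattern_W w tau tau' :
  same_pattern tau tau' -> same_pattern (W_tau w tau) (W_tau w tau').
Proof.
case=> tE bE lE; split=> [a|b|a b]; rewrite ?top_occ_W_tau ?bot_occ_W_tau //.
by rewrite !linked_W_tau.
Qed.

Lemma same_pattern_WM w w' tau :
  same_pattern (W_tau (w * w')%g tau) (W_tau w (W_tau w' tau)).
Proof.
by split=> [a|b|a b]; rewrite ?(top_occ_W_tau, bot_occ_W_tau, linked_W_tau) ?permM.
Qed.

Lemma same_pattern_W1 tau : same_pattern (W_tau 1%g tau) tau.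
Proof.
by split=> [a|b|a b]; rewrite ?(top_occ_W_tau, bot_occ_W_tau, linked_W_tau) ?perm1.
Qed.

Lemma tau_orbit_W w tau tau' :
  tau_orbit tau = tau_orbit tau' ->
  tau_orbit (W_tau w tau) = tau_orbit (W_tau w tau').
Proof. by move/tau_orbitE=> tt'; apply/tau_orbitE/same_pattern_W. Qed.

Lemma tau_orbit_WM w w' tau :
  tau_orbit (W_tau (w * w')%g tau) = tau_orbit (W_tau w (W_tau w' tau)).
Proof. exact/tau_orbitE/same_pattern_WM. Qed.

Lemma tau_orbit_W1 tau : tau_orbit (W_tau 1%g tau) = tau_orbit tau.
Proof. exact/tau_orbitE/same_pattern_W1. Qed.

(** The pattern of the matrix with columns e_i + e'_i (i < k), then e_i
    (k <= i < k + s), then e'_i (k <= i < k + t).  It is a predicate on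
    patterns and not an explicit matrix because orbits only depend on
    patterns. *)
Definition is_std k s t tau :=
  [/\ forall a, top_occ tau a = (a < k + s)%N,
      forall b, bot_occ tau b = (b < k + t)%N
    & forall a b, linked tau a b = ((a == b :> nat) && (a < k)%N)].

(** A single 1 in bottom row b >= k is put in column b + s, after the k columns
    with two 1's and the s columns with a single 1 in the top block. *)
Definition std_mx k s : 'M[F]_(p + q, r) :=
  \matrix_(i, c) (match fintype.split i with
    | inl a => (a == c :> nat) && (a < k + s)%N
    | inr b => c == (if (b < k)%N then b : nat else b + s)%N :> nat
    end)%:R.

Lemma std_mx_top k s a c :
  std_mx k s (lshift q a) c = ((a == c :> nat) && (a < k + s)%N)%:R.
Proof. by rewrite mxE split_lshift. Qed.

Lemma std_mx_bot k s b c :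
  std_mx k s (rshift p b) c
    = (c == (if (b < k)%N then b : nat else b + s)%N :> nat)%:R.
Proof. by rewrite mxE split_rshift. Qed.

Lemma std_exists k s t :
  (k + s <= p)%N -> (k + t <= q)%N -> r = (k + s + t)%N ->
  exists tau, is_std k s t tau.
Proof.
move=> le_p le_q rE.
have bE (b : bool) : (b%:R != 0 :> F) = b.
  by case: b; rewrite ?oner_eq0 ?eqxx.
have inj_bot : injective (fun b => if (b < k)%N then b else b + s)%N.
  by move=> b b'; case: ltnP => ?; case: ltnP => ?; lia.
have tP : [&& \rank (std_mx k s) == r, is_partial_perm (usubmx (std_mx k s))
             & is_partial_perm (dsubmx (std_mx k s))].
  apply/and3P; split.
  - rewrite rank_disjoint_cols => [|i c c'].
      apply/eqP; rewrite -[RHS]card_ord; apply: eq_card => c; rewrite !inE.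
      apply/existsP; have [lt_c|le_c] := ltnP c (k + s).
        exists (lshift q (Ordinal (leq_trans lt_c le_p))).
        by rewrite std_mx_top bE eqxx.
      have lt_b : (c - s < q)%N by have := ltn_ord c; lia.
      exists (rshift p (Ordinal lt_b)); rewrite std_mx_bot bE /=.
      by case: ltnP => ?; lia.
    case: (split_ordP i) => {}i ->; rewrite ?std_mx_top ?std_mx_bot !bE.
      by move=> /andP[/eqP + _] /andP[/eqP + _] => -> /val_inj.
    by move=> /eqP + /eqP + => <- /val_inj.
  - apply/partial_permP; split=> [i j|i j j'|i i' j];
      rewrite ![usubmx _ _ _]mxE !std_mx_top !bE //.
      by move=> /andP[/eqP + _] /andP[/eqP + _] => -> /val_inj.
    by move=> /andP[/eqP + _] /andP[/eqP + _] => <- /val_inj.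
  - apply/partial_permP; split=> [i j|i j j'|i i' j];
      rewrite ![dsubmx _ _ _]mxE !std_mx_bot !bE //.
      by move=> /eqP + /eqP + => <- /val_inj.
    by move=> /eqP + /eqP => -> /inj_bot/val_inj.
exists (TauMx tP).
have topE a c : top (TauMx tP) a c = (a == c :> nat) && (a < k + s)%N.
  by rewrite /top std_mx_top bE.
have botE b c : bot (TauMx tP) b c
     = (c == (if (b < k)%N then b : nat else b + s)%N :> nat).
  by rewrite /bot std_mx_bot bE.
split=> [a|b|a b].
- apply/existsP/idP=> [[c]|lt_a]; first by rewrite topE => /andP[].
  have lt_r : (a < r)%N by lia.
  by exists (Ordinal lt_r); rewrite topE eqxx.
- apply/existsP/idP=> [[c]|lt_b].
    by rewrite botE; have := ltn_ord c; case: (ltnP b k) => ?; lia.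
  have lt_r : ((if (b < k)%N then b : nat else b + s) < r)%N.
    by case: (ltnP b k) => ?; lia.
  by exists (Ordinal lt_r); rewrite botE.
- apply/existsP/andP=> [[c]|[/eqP ab lt_a]].
    rewrite topE botE => /andP[/andP[/eqP ac lt_a] /eqP].
    by case: ltnP => ? cb; split; rewrite ?ac ?cb //; lia.
  have lt_r : (a < r)%N by lia.
  exists (Ordinal lt_r); rewrite topE botE eqxx /= -ab lt_a eqxx andbT.
  by rewrite (leq_trans lt_a) ?leq_addr.
Qed.

Lemma is_std_uniq k s t tau tau' :
  is_std k s t tau -> is_std k s t tau' -> same_pattern tau tau'.
Proof.
by move=> [t1 b1 l1] [t2 b2 l2]; split=> [a|b|a b]; rewrite ?t1 ?t2 ?b1 ?b2 ?l1 ?l2.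
Qed.

(** List the linked pairs; the rows on the top side are listed as the first
    components of these pairs, then the other occupied rows, then the empty
    ones, and likewise on the bottom side.  These two enumerations are the
    permutations needed, and r = k + s + t is [tail_cols_sum] for the full
    tails. *)
Lemma to_std tau : exists w k s t,
  [/\ (k + s <= p)%N, (k + t <= q)%N, r = (k + s + t)%N
    & is_std k s t (W_tau w tau)].
Proof.
pose Z := [seq ab <- enum {: 'I_p * 'I_q} | linked tau ab.1 ab.2].
have memZ a b : ((a, b) \in Z) = linked tau a b.
  by rewrite mem_filter mem_enum andbT.
have linkT a b : linked tau a b -> top_occ tau a.
  by case/existsP=> c /andP[ac _]; apply/existsP; exists c.
have linkB a b : linked tau a b -> bot_occ tau b.
  by case/existsP=> c /andP[_ bc]; apply/existsP; exists c.
have linkTI a a' b : linked tau a b -> linked tau a' b -> a = a'.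
  case/existsP=> c /andP[ac bc] /existsP[c' /andP[ac' bc']].
  by rewrite -(bot_col_inj bc bc') in ac'; apply: top_row_inj ac ac'.
have linkBI a b b' : linked tau a b -> linked tau a b' -> b = b'.
  case/existsP=> c /andP[ac bc] /existsP[c' /andP[ac' bc']].
  by rewrite -(top_col_inj ac ac') in bc'; apply: bot_row_inj bc bc'.
have uZ : uniq Z by rewrite filter_uniq ?enum_uniq.
have uZ1 : uniq (unzip1 Z).
  rewrite map_inj_in_uniq // => -[a b] [a' b']; rewrite !memZ /=.
  by move=> ab + aa'; rewrite -aa' => /(linkBI _ _ _ ab)->.
have uZ2 : uniq (unzip2 Z).
  rewrite map_inj_in_uniq // => -[a b] [a' b']; rewrite !memZ /=.
  by move=> ab + bb'; rewrite -bb' => /(linkTI _ _ _ ab)->.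
pose S := [seq a <- enum 'I_p | top_occ tau a & a \notin unzip1 Z].
pose T := [seq b <- enum 'I_q | bot_occ tau b & b \notin unzip2 Z].
have memS a : (a \in unzip1 Z ++ S) = top_occ tau a.
  rewrite mem_cat mem_filter mem_enum andbT.
  case: (boolP (a \in unzip1 Z)) => [/mapP[[a' b] + ->]|_]; last by rewrite andbT.
  by rewrite memZ => /linkT->.
have memT b : (b \in unzip2 Z ++ T) = bot_occ tau b.
  rewrite mem_cat mem_filter mem_enum andbT.
  case: (boolP (b \in unzip2 Z)) => [/mapP[[a b'] + ->]|_]; last by rewrite andbT.
  by rewrite memZ => /linkB->.
have uS : uniq (unzip1 Z ++ S).
  rewrite cat_uniq uZ1 filter_uniq ?enum_uniq // andbT.
  by apply/hasPn=> a; rewrite mem_filter => /andP[/andP[]].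
have uT : uniq (unzip2 Z ++ T).
  rewrite cat_uniq uZ2 filter_uniq ?enum_uniq // andbT.
  by apply/hasPn=> b; rewrite mem_filter => /andP[/andP[]].
have [u [uE uI]] := perm_of_uniq uS; have [v [vE vI]] := perm_of_uniq uT.
have size1 : size (unzip1 Z ++ S) = (size Z + size S)%N by rewrite size_cat size_map.
have size2 : size (unzip2 Z ++ T) = (size Z + size T)%N by rewrite size_cat size_map.
have le_p : (size Z + size S <= p)%N.
  by rewrite -size1 -(card_uniqP uS) -[X in (_ <= X)%N](card_ord p) max_card.
have le_q : (size Z + size T <= q)%N.
  by rewrite -size2 -(card_uniqP uT) -[X in (_ <= X)%N](card_ord q) max_card.
exists (u, v), (size Z), (size S), (size T); split=> //.
  have := tail_cols_sum tau 0 0; rewrite tail_cols_rank.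
  have -> : (\sum_(a : 'I_p | 0 <= a) top_occ tau a)%N = (size Z + size S)%N.
    rewrite -size1 -(card_uniqP uS) -sum1_card [RHS]big_mkcond /=.
    by apply: eq_bigr => a _; rewrite memS; case: top_occ.
  have -> : (\sum_(b : 'I_q | 0 <= b) bot_occ tau b)%N = (size Z + size T)%N.
    rewrite -size2 -(card_uniqP uT) -sum1_card [RHS]big_mkcond /=.
    by apply: eq_bigr => b _; rewrite memT; case: bot_occ.
  rewrite pair_big /=.
  have -> : (\sum_(x : 'I_p * 'I_q | (0 <= x.1) && (0 <= x.2)) linked tau x.1 x.2)%N
            = size Z.
    rewrite -(card_uniqP uZ) -sum1_card [RHS]big_mkcond /=.
    by apply: eq_bigr => -[a b] _; rewrite memZ; case: linked.
  lia.
split=> [a|b|a b].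
- by rewrite top_occ_W_tau -memS uI size1.
- by rewrite bot_occ_W_tau -memT vI size2.
rewrite linked_W_tau /=.
have uZE (a' : 'I_p) : (a' < size Z)%N -> exists b', linked tau (u a') b' /\
     forall b0 : 'I_q, b0 = a' :> nat -> v b0 = b'.
  move=> lt_a; have lt_q : (a' < q)%N by lia.
  have [a0 b0] : 'I_p * 'I_q by split; [exact: a' | exact: Ordinal lt_q].
  exists (nth (a0, b0) Z a').2; split.
    rewrite (uE _ a0) ?size1 ?ltn_addr // nth_cat size_map lt_a.
    rewrite (nth_map (a0, b0)) //; rewrite -memZ.
    by rewrite -surjective_pairing mem_nth.
  move=> b1 b1E; rewrite (vE _ b0) ?size2 b1E ?ltn_addr // nth_cat size_map lt_a.
  by rewrite (nth_map (a0, b0)).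
apply/idP/andP=> [ab|[/eqP ab lt_a]].
  have lt_a : (a < size Z)%N.
    have : u a \in unzip1 Z by apply/mapP; exists (u a, v b); rewrite ?memZ.
    case/(nthP (u a))=> i; rewrite size_map => lt_i ui.
    have lt_ip : (i < p)%N by lia.
    have : u (Ordinal lt_ip) = u a.
      by rewrite (uE _ (u a)) ?size1 ?ltn_addr // nth_cat size_map lt_i.
    by move/perm_inj <-.
  split=> //; have [b' [ab' b'E]] := uZE a lt_a.
  have lt_q : (a < q)%N by lia.
  have := b'E (Ordinal lt_q) erefl; rewrite -(linkBI _ _ _ ab ab').
  by move/perm_inj <-.
by have [b' [ab' ->]] := uZE a lt_a.
Qed.

Lemma card_lt_perm n m (u : 'S_n) : (m <= n)%N -> #|[pred i | (u i < m)%N]| = m.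
Proof.
move=> le_mn; rewrite -[RHS](card_ord m) -(card_imset _ (@perm_inj _ u)).
have wI : injective (widen_ord le_mn).
  by move=> i j ij; apply: val_inj; apply: (congr1 val ij).
rewrite -(card_imset _ wI); apply: eq_card => i.
apply/imsetP/imsetP=> [[j + ->]|[j _ ->]].
  by rewrite inE => lt_m; exists (Ordinal lt_m) => //; apply: val_inj.
exists ((u^-1)%g (widen_ord le_mn j)); last by rewrite permKV.
by rewrite inE permKV /= ltn_ord.
Qed.

(** k + s and k + t are the numbers of occupied rows in the two blocks, and their
    sum exceeds r by k. *)
Lemma is_std_inj k s t k' s' t' w tau tau' :
  (k + s <= p)%N -> (k + t <= q)%N -> r = (k + s + t)%N ->
  (k' + s' <= p)%N -> (k' + t' <= q)%N -> r = (k' + s' + t')%N ->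
  is_std k s t tau -> is_std k' s' t' tau' ->
  same_pattern (W_tau w tau) tau' -> [/\ k = k', s = s' & t = t'].
Proof.
move=> p1 q1 r1 p2 q2 r2 [t1 b1 _] [t2 b2 _] [tE bE _].
have ks : (k + s = k' + s')%N.
  rewrite -(card_lt_perm w.1 p1) -(card_lt_perm 1%g p2).
  by apply: eq_card => a; rewrite !inE -t1 -top_occ_W_tau tE t2 perm1.
have kt : (k + t = k' + t')%N.
  rewrite -(card_lt_perm w.2 q1) -(card_lt_perm 1%g q2).
  by apply: eq_card => b; rewrite !inE -b1 -bot_occ_W_tau bE b2 perm1.
by split; lia.
Qed.

(** The three blocks of each side are the linked rows, the other occupied rows
    and the empty rows, so they are preserved; the first blocks of the two sides
    are permuted in the same way because links are preserved. *)
Lemma stab_std k s t w tau : (k + s <= p)%N -> (k + t <= q)%N ->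
  is_std k s t tau ->
  same_pattern (W_tau w tau) tau <-> w \in H_set p q k s t.
Proof.
move=> le_p le_q [tE bE lE]; split=> [[tW bW lW]|].
  have top_lt a : (w.1 a < k + s)%N = (a < k + s)%N.
    by rewrite -!tE -[RHS]tW top_occ_W_tau.
  have bot_lt b : (w.2 b < k + t)%N = (b < k + t)%N.
    by rewrite -!bE -[RHS]bW bot_occ_W_tau.
  have link a b : (w.1 a == w.2 b :> nat) && (w.1 a < k)%N
                  = (a == b :> nat) && (a < k)%N.
    by rewrite -!lE -[RHS]lW linked_W_tau.
  have top_k a : (w.1 a < k)%N = (a < k)%N.
    apply/idP/idP=> lt_k.
      have lt_q : (w.1 a < q)%N by lia.
      have := link a ((w.2^-1)%g (Ordinal lt_q)).
      by rewrite permKV /= eqxx lt_k => /esym/andP[].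
    have lt_q : (a < q)%N by lia.
    by have := link a (Ordinal lt_q); rewrite eqxx lt_k => /andP[].
  have agree (a : 'I_p) (b : 'I_q) : a = b :> nat -> (a < k)%N ->
      w.1 a = w.2 b :> nat.
    by move=> ab lt_k; have := link a b; rewrite ab eqxx -ab lt_k => /andP[/eqP].
  have bot_k b : (w.2 b < k)%N = (b < k)%N.
    apply/idP/idP=> lt_k.
      have lt_p : (w.2 b < p)%N by lia.
      have := link ((w.1^-1)%g (Ordinal lt_p)) b.
      by rewrite permKV /= eqxx lt_k => /esym/andP[/eqP<-].
    have lt_p : (b < p)%N by lia.
    by rewrite -(agree (Ordinal lt_p)) // top_k.
  have [|i lt_i|a1 A1] := @acts_on_block_exists p k 0 w.1; first by lia.
    by rewrite /= add0n top_k.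
  have [|i lt_i|a2 A2] := @acts_on_block_exists p s k w.1; first by lia.
    by rewrite top_lt leqNgt top_k -leqNgt.
  have [|i lt_i|a3 A3] := @acts_on_block_exists p (p - k - s) (k + s) w.1; first by lia.
    by rewrite leqNgt top_lt -leqNgt; have := ltn_ord (w.1 i); lia.
  have [|i lt_i|b2 B2] := @acts_on_block_exists q t k w.2; first by lia.
    by rewrite bot_lt leqNgt bot_k -leqNgt.
  have [|i lt_i|b3 B3] := @acts_on_block_exists q (q - k - t) (k + t) w.2; first by lia.
    by rewrite leqNgt bot_lt -leqNgt; have := ltn_ord (w.2 i); lia.
  rewrite inE; apply/existsP; exists a1; apply/existsP; exists a2.
  apply/existsP; exists a3; apply/existsP; exists b2; apply/existsP; exists b3.
  rewrite A1 A2 A3 B2 B3 /= andbT; apply/acts_on_blockP=> b j bj.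
  have lt_p : (b < p)%N by have := ltn_ord j; lia.
  rewrite -(agree (Ordinal lt_p)) //; last by have := ltn_ord j; rewrite /=; lia.
  by have /acts_on_blockP := A1; apply.
rewrite inE => /existsP[a1 /existsP[a2 /existsP[a3 /existsP[b2 /existsP[b3]]]]].
case/and5P=> A1 A2 A3 B1 /andP[B2 B3].
have topP a : (w.1 a < k)%N = (a < k)%N /\ (w.1 a < k + s)%N = (a < k + s)%N.
  exact: block_bounds le_p (ltn_ord a) (acts_on_block_range A1)
           (acts_on_block_range A2) (acts_on_block_range A3).
have botP b : (w.2 b < k)%N = (b < k)%N /\ (w.2 b < k + t)%N = (b < k + t)%N.
  exact: block_bounds le_q (ltn_ord b) (acts_on_block_range B1)
           (acts_on_block_range B2) (acts_on_block_range B3).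
split=> [a|b|a b].
- by rewrite top_occ_W_tau !tE (topP a).2.
- by rewrite bot_occ_W_tau !bE (botP b).2.
rewrite linked_W_tau !lE (topP a).1.
case: (ltnP a k) => [lt_a|_]; rewrite ?andbF ?andbT //.
have [lt_b|le_b] := ltnP b k; last first.
  rewrite (ltn_eqF (leq_trans lt_a le_b)); apply: ltn_eqF.
  by rewrite (@leq_trans k) ?(topP a).1 // leqNgt (botP b).1 -leqNgt.
have /acts_on_blockP/(_ a (Ordinal lt_a) erefl) -> := A1.
have /acts_on_blockP/(_ b (Ordinal lt_b) erefl) -> := B1.
by rewrite eqn_add2l (inj_eq val_inj) (inj_eq perm_inj).
Qed.

End StandardPatterns.

(** * Permutation representations *)

Section DirectSums.
Variables (C : fieldType) (gT : finGroupType) (G : {group gT}).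

(** The iterated sum is a nested cartesian product whose type depends on the list
    of indices.  This describes it as a quotient of the product of all
    the V i, where only the components with i in l and P i matter, so that maps
    into it can be given componentwise. *)
Lemma big_sum_repP (I : eqType) (l : seq I) (P : pred I)
    (V : I -> representation C G) :
  uniq l ->
  exists T : (forall i, rep_space (V i)) ->
      rep_space (\big[@sum_rep C gT G / zero_rep C G]_(i <- l | P i) V i),
    [/\ forall a x y, T (fun i => a *: x i + y i) = a *: T x + T y,
        forall g x, T (fun i => rep_act g (x i)) = rep_act g (T x),
        forall x y, T x = T y <-> forall i, i \in l -> P i -> x i = y i
      & forall z, exists x, T x = z].
Proof.
elim: l => [_|i l IHl] /=.
  rewrite big_nil; exists (fun=> 0); split=> //= [a x y|z].
    by rewrite scaler0 addr0.
  by exists (fun=> 0); apply/rowP=> -[].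
case/andP=> nil /IHl[T [Tlin Tact Tinj Tsurj]]; rewrite big_cons.
case: ifPn => Pi; last first.
  exists T; split=> // x y; rewrite Tinj; split=> xy j.
    by rewrite inE => /predU1P[->|]; [rewrite (negPf Pi) | exact: xy].
  by move=> jl; apply: xy; rewrite inE jl orbT.
exists (fun x => (x i, T x)); split=> /=.
- by move=> a x y; rewrite Tlin.
- by move=> g x; rewrite Tact.
- move=> x y; split=> [[xyi /Tinj xy] j|xy].
    by rewrite inE => /predU1P[->|]; [ | exact: xy].
  congr (_, _); first by apply: xy; rewrite ?mem_head.
  by apply/Tinj=> j jl; apply: xy; rewrite inE jl orbT.
- case=> zi z; have [x xz] := Tsurj z; exists (dfwith x zi).
  rewrite dfwith_in -xz; congr (_, _); apply/Tinj => j jl _.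
  by rewrite dfwith_out //; apply: contraNneq nil => ->.
Qed.

End DirectSums.

Lemma inj_surj_bij (T U : Type) (f : T -> U) :
  injective f -> (forall z, exists x, f x = z) -> bijective f.
Proof.
move=> f_inj /boolp.choice[g gK]; exists g => // x.
by apply: f_inj; rewrite gK.
Qed.

Lemma conj_rep (C : fieldType) (gT : finGroupType) (G : {group gT})
    (U : lmodType C) (V : representation C G) (f : U -> rep_space V) 
    (f' : rep_space V -> U) :
  linear f -> cancel f f' -> cancel f' f ->
  is_rep G (fun g u => f' (rep_act g (f u))).
Proof.
move=> flin fK f'K; have [alin a1 aM] := rep_actP V.
split=> [g a u v|u|g h Gg Gh u].
- by apply: (can_inj fK); rewrite f'K !flin alin !f'K.
- by rewrite a1 fK.
- by rewrite aM // f'K.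
Qed.

Section PermutationRepresentations.
Variables (C : fieldType) (gT : finGroupType) (O : choiceType).
Variables (act : gT -> O -> O) (I : finType) (adm : pred I).
Variables (base : I -> O) (H : I -> {group gT}).
Hypothesis act1 : forall o, act 1%g o = o.
Hypothesis actM : forall g h o, act (g * h)%g o = act g (act h o).
Hypothesis base_cover : forall o, exists i g, adm i /\ o = act g (base i).
Hypothesis base_inj : forall i j g,
  adm i -> adm j -> act g (base i) = base j -> i = j.
Hypothesis base_stab : forall i g,
  adm i -> act g (base i) = base i <-> g \in H i.

Let V i := ind_rep (trivial_rep C (H i)).

Let actK g : cancel (act g) (act g^-1%g).
Proof. by move=> o; rewrite -actM mulVg act1. Qed.

Let actVK g : cancel (act g^-1%g) (act g).
Proof. by move=> o; rewrite -actM mulgV act1. Qed.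

(** The component of index i of a vector v is the function whose value at g is
    the coefficient of v at g^-1 x_i, where x_i is the base point of the orbit.
    The inverse turns left translations of points into right translations of
    functions.  Outside adm the point x_i is arbitrary and so is the
    component. *)
Lemma orbit_coefficients : exists phi : forall i, {malg C[O]} -> rep_space (V i),
  forall i v g, adm i -> ind_val (phi i v) g = v@_(act g^-1%g (base i)).
Proof.
suff phiP i : exists phi : {malg C[O]} -> rep_space (V i),
    forall v g, adm i -> ind_val (phi v) g = v@_(act g^-1%g (base i)).
  by exists (fun i => projT1 (boolp.cid (phiP i))) => i; case: boolp.cid.
case: (boolP (adm i)) => [ai|_]; last by exists (fun=> 0).
have coefP (v : {malg C[O]}) :
    [ffun g => v@_(act g^-1%g (base i))] \in ind_pred (V:=trivial_rep C (H i)).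
  apply/ind_predP=> h g Hh; rewrite !ffunE invMg actM.
  by rewrite (iffRL (base_stab _ ai)) ?groupV.
by exists (fun v => IndSpace (coefP v)) => v g _; rewrite ffunE.
Qed.

(** H i-invariance makes the value at g depend on the point g^-1 x_i only, and
    each point lies in exactly one orbit. *)
Lemma ind_rep_extends (y : forall i, rep_space (V i)) : exists c : O -> C,
  forall i g, adm i -> c (act g^-1%g (base i)) = ind_val (y i) g.
Proof.
suff /boolp.choice[c cP] : forall o, exists c, forall i g,
    adm i -> o = act g^-1%g (base i) -> c = ind_val (y i) g.
  by exists c => i g ai; apply: cP.
move=> o; have [j [h [aj oE]]] := base_cover o.
exists (ind_val (y j) h^-1%g) => i g ai; rewrite oE => eq_act.
have ghj : act (g * h)%g (base j) = base i by rewrite actM eq_act actVK.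
have eq_ij := base_inj aj ai ghj; subst j.
have Hgh : (g * h)%g \in H i by apply/(base_stab _ ai).
by have /ind_predP/(_ _ h^-1%g Hgh) := ind_valP (y i); rewrite mulgK.
Qed.

(** The action on the permutation module is transported from the direct sum
    through the bijection given by the coefficients, so that only its value on
    basis vectors has to be computed. *)
Lemma perm_rep_iso : exists rho : gT -> {malg C[O]} -> {malg C[O]},
  [/\ is_rep [set: gT]%G rho,
      forall g o, rho g << o >> = << act g o >>
    & rep_iso [set: gT]%G rho
        (@rep_act C _ _
           (\big[@sum_rep C _ _ / zero_rep C _]_(i | adm i) V i))].
Proof.
have [T [Tlin Tact Tinj Tsurj]] := big_sum_repP adm V (index_enum_uniq _).
have [phi phiE] := orbit_coefficients.
pose Phi v := T (fun i => phi i v).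
have Phi_lin : linear Phi.
  move=> a u v; rewrite /Phi -Tlin; apply/Tinj => i _ ai.
  apply/val_inj/ffunP=> g; rewrite !ffunE /=.
  by rewrite !(phiE _ _ _ ai) mcoeffD mcoeffZ.
have Phi_inj : injective Phi.
  move=> u v /Tinj uv; apply/malgP=> o; have [i [g [ai ->]]] := base_cover o.
  by rewrite -[g]invgK -!(phiE _ _ _ ai) (uv _ (mem_index_enum _) ai).
have Phi_surj z : exists v, Phi v = z.
  have [y <-] := Tsurj z; have [c cP] := ind_rep_extends y.
  pose S := finmap.seq_fset tt
    [seq act ig.2^-1%g (base ig.1) | ig <- enum {: I * gT}].
  exists [malg o in S => c o]; apply/Tinj=> i _ ai.
  apply/val_inj/ffunP=> g; rewrite /= (phiE _ _ _ ai) mcoeffE.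
  rewrite finmap.seq_fsetE (cP _ _ ai).
  by rewrite (_ : _ \in _ = true) //; apply/mapP; exists (i, g); rewrite ?mem_enum.
have Phi_act g o : Phi << act g o >> = rep_act g (Phi << o >>).
  rewrite /Phi -Tact; apply/Tinj=> i _ ai; apply/val_inj/ffunP=> h.
  rewrite ffunE /= !(phiE _ _ _ ai) !mcoeffU invMg actM.
  by rewrite -(can_eq (actK g^-1%g)) actK.
have [Psi PhiK PsiK] := inj_surj_bij Phi_inj Phi_surj.
exists (fun g v => Psi (rep_act g (Phi v))); split.
- exact: conj_rep.
- by move=> g o; rewrite -Phi_act PhiK.
- by exists Phi; split=> [|| g _ v]; [exact: Phi_lin | exists Psi | rewrite PsiK].
Qed.

End PermutationRepresentations.

(** * The orbit space as a sum of induced representations *)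

Theorem theorem8p1 (R : realType) (F : fieldType) (hF : 2%N \notin [pchar F])
    (p q r : nat) (hp : (1 <= p)%N) (hq : (1 <= q)%N)
    (hr : (1 <= r <= p + q - 1)%N) :
  exists rho : 'S_p * 'S_q ->
      orbit_space F p q r R[i] -> orbit_space F p q r R[i],
    [/\ is_rep [set: 'S_p * 'S_q]%G rho,
        forall (w : 'S_p * 'S_q) (tau : tau_mx F p q r),
          rho w (xi R[i] tau) = xi R[i] (W_tau w tau)
      & rep_iso [set: 'S_p * 'S_q]%G rho
          (@rep_act R[i] _ _
             (\big[@sum_rep R[i] _ _ / zero_rep R[i] _]_(
                 x : 'I_r.+1 * 'I_r.+1 * 'I_r.+1
                 | let: (k, s, t) := x in
                   [&& (k + s <= p)%N, (k + t <= q)%N & r == (k + s + t)%N])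
               (let: (k, s, t) := x in
                ind_rep (trivial_rep R[i] (H_group p q k s t)))))].
Proof.
have le_r : (r <= p + q)%N by lia.
pose adm (x : 'I_r.+1 * 'I_r.+1 * 'I_r.+1) := let: (k, s, t) := x in
  [&& (k + s <= p)%N, (k + t <= q)%N & r == (k + s + t)%N].
have admP x : adm x ->
    [/\ (x.1.1 + x.1.2 <= p)%N, (x.1.1 + x.2 <= q)%N
      & r = (x.1.1 + x.1.2 + x.2)%N].
  by case: x => [[k s] t] /and3P[? ? /eqP].
pose H (x : 'I_r.+1 * 'I_r.+1 * 'I_r.+1) := H_group p q x.1.1 x.1.2 x.2.
rewrite (_ : \big[_/_]_(x | _) _ = \big[@sum_rep R[i] _ _ / zero_rep R[i] _]_(
    x | adm x) ind_rep (trivial_rep R[i] (H x))); last first.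
  by apply: eq_bigr => -[[k s] t].
have /boolp.choice[tau_of tau_ofP] (o : @K_orbits F p q r) :
  exists tau : tau_mx F p q r, tau_orbit tau = o by exact: tau_orbit_surj.
have /boolp.choice[std stdP] (x : 'I_r.+1 * 'I_r.+1 * 'I_r.+1) :
    exists tau : tau_mx F p q r, adm x -> is_std x.1.1 x.1.2 x.2 tau.
  case: (boolP (adm x)) => [/admP[le_p le_q rE]|_].
    by have [tau ?] := std_exists F le_p le_q rE; exists tau.
  (* An admissible triple is needed for a value at the other triples. *)
  have [|||tau0 _] := @std_exists F p q r 0 (minn p r) (r - minn p r); try lia.
  by exists tau0.
(* The choice of tau_of is immaterial by tau_orbit_W. *)
pose act w o := tau_orbit (W_tau w (tau_of o)).
have act_tau w tau : act w (tau_orbit tau) = tau_orbit (W_tau w tau).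
  exact/tau_orbit_W/tau_ofP.
have [||o|x y w ax ay|x w ax|rho [rhoP rhoE rhoI]] :=
    @perm_rep_iso R[i] _ _ act _ adm (fun x => tau_orbit (std x)) H.
- by move=> o; rewrite -[RHS]tau_ofP -[RHS]tau_orbit_W1.
- by move=> g h o; rewrite /act -/(act g _) act_tau tau_orbit_WM.
- have [w [k [s [t [le_p le_q rE tauS]]]]] := to_std (tau_of o).
  have lt_k : (k < r.+1)%N by lia.
  have lt_s : (s < r.+1)%N by lia.
  have lt_t : (t < r.+1)%N by lia.
  pose x := (Ordinal lt_k, Ordinal lt_s, Ordinal lt_t).
  have ax : adm x by rewrite /adm /= le_p le_q rE eqxx.
  exists x, w^-1%g; split=> //; rewrite act_tau -[LHS]tau_ofP -[LHS]tau_orbit_W1.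
  rewrite -(mulVg w) tau_orbit_WM.
  by apply/tau_orbit_W/tau_orbitE; exact: is_std_uniq tauS (stdP x ax).
- rewrite act_tau => /tau_orbitE wxy.
  have [p1 q1 r1] := admP x ax; have [p2 q2 r2] := admP y ay.
  have [kk ss tt] := is_std_inj p1 q1 r1 p2 q2 r2 (stdP x ax) (stdP y ay) wxy.
  case: x y kk ss tt {ax ay wxy p1 q1 r1 p2 q2 r2} => [[k s] t] [[k' s'] t'] /=.
  by move=> /val_inj-> /val_inj-> /val_inj->.
- have [p1 q1 r1] := admP x ax.
  by rewrite act_tau; split=> [/tau_orbitE|] wx; [|apply/tau_orbitE];
     apply/(stab_std w p1 q1 (stdP x ax)).
- by exists rho; split=> // w tau; rewrite /xi rhoE act_tau.
Qed.
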